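(* Let $P_\lambda(n)$ be defined by $\sum_{n=0}^{\infty}P_\lambda(n)q^n=\lambda(q)$, where $\lambda(q)=\sum_{n=0}^{\infty}\dfrac{(-1)^nq^n(q;q^2)_n}{(-q;q)_n}$. Then for every integer $n\ge 0$, $$\sum_{m=0}^{\infty}(-1)^m(2m+1)P_\lambda\Big(6n-3m(m+1)+4\Big)$$ $$=6\sum_{l=0}^{\infty}(-1)^l(2l+1)\,p_{2d}\Big(n-3l(l+1)\Big)+12\sum_{l=0}^{\infty}\sum_{k=1}^{\infty}(-1)^{l+k}(2l+1)\,p_{2d}\Big(n-3k^2-3l(l+1)\Big).$$
   Context: Notation: $(b;q)_n=\prod_{k=0}^{n-1}(1-bq^k)$ and $\ell_k=\prod_{m\ge1}(1-q^{km})$. $p_{2d}(n)$ is the number of partitions of $n$ into distinct parts with $2$ copies (colours), with $\sum_{n\ge0}p_{2d}(n)q^n=(\ell_2/\ell_1)^2$. The function $\lambda(q)$ is a sixth order mock theta function. Convention: $P_\lambda(m)=0$ and $p_{2d}(m)=0$ for $m<0$. *)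

(* Defs.v *)
From HB Require Import structures.
From mathcomp Require Import all_boot all_algebra.
From mathcomp Require Import boolp classical_sets functions cardinality fsbigop.

Set Implicit Arguments.
Unset Strict Implicit.
Unset Printing Implicit Defensive.
Import GRing.Theory.
Local Open Scope ring_scope.

(* A record rather than an alias of [nat -> R], which already carries the
   pointwise ring structure; here multiplication is the Cauchy product. *)
Record fps (R : Type) := FPS { coeffs : nat -> R }.

Section FPS.
Variable R : comUnitRingType.
Implicit Types f g h : fps R.

Lemma fpsP f g : (forall n, coeffs f n = coeffs g n) -> f = g.
Proof. by case: f g => [f] [g] /= fg; congr FPS; apply/funext. Qed.

HB.instance Definition _ := gen_eqMixin (fps R).
HB.instance Definition _ := gen_choiceMixin (fps R).

Definition fps_zero : fps R := FPS (fun=> 0).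
Definition fps_opp f := FPS (fun n => - coeffs f n).
Definition fps_add f g := FPS (fun n => coeffs f n + coeffs g n).

Lemma fps_addA : associative fps_add.
Proof. by move=> f g h; apply: fpsP => n /=; rewrite addrA. Qed.
Lemma fps_addC : commutative fps_add.
Proof. by move=> f g; apply: fpsP => n /=; rewrite addrC. Qed.
Lemma fps_add0 : left_id fps_zero fps_add.
Proof. by move=> f; apply: fpsP => n /=; rewrite add0r. Qed.
Lemma fps_addN : left_inverse fps_zero fps_opp fps_add.
Proof. by move=> f; apply: fpsP => n /=; rewrite addNr. Qed.

HB.instance Definition _ :=
  GRing.isZmodule.Build (fps R) fps_addA fps_addC fps_add0 fps_addN.

Definition fps_one : fps R := FPS (fun n => (n == 0%N)%:R).
Definition fps_mul f g :=
  FPS (fun n => \sum_(j < n.+1) coeffs f j * coeffs g (n - j)).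

Definition fps_trunc n f : {poly R} := \poly_(i < n.+1) coeffs f i.

Lemma coef_fps_trunc n f i : (i <= n)%N -> (fps_trunc n f)`_i = coeffs f i.
Proof. by move=> lein; rewrite coef_poly ltnS lein. Qed.

Lemma fps_mul_trunc n f g i : (i <= n)%N ->
  coeffs (fps_mul f g) i = (fps_trunc n f * fps_trunc n g)`_i.
Proof.
move=> lein; rewrite coefM; apply: eq_bigr => j _.
by rewrite !coef_fps_trunc // (leq_trans _ lein) ?leq_subr // -ltnS.
Qed.

Lemma fps_mulA : associative fps_mul.
Proof.
move=> f g h; apply: fpsP => n.
rewrite !(@fps_mul_trunc n) //.
transitivity ((fps_trunc n f * (fps_trunc n g * fps_trunc n h))`_n).
  rewrite [LHS]coefM [RHS]coefM; apply: eq_bigr => j _; congr (_ * _).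
  by rewrite coef_fps_trunc ?leq_subr // (@fps_mul_trunc n) ?leq_subr.
rewrite mulrA [LHS]coefM [RHS]coefM; apply: eq_bigr => j _; congr (_ * _).
have jn : (j <= n)%N by rewrite -ltnS.
by rewrite coef_fps_trunc // (@fps_mul_trunc n).
Qed.

Lemma fps_mulC : commutative fps_mul.
Proof. by move=> f g; apply: fpsP => n; rewrite !(@fps_mul_trunc n) // mulrC. Qed.

Lemma fps_mul1 : left_id fps_one fps_mul.
Proof.
move=> f; apply: fpsP => n /=; rewrite big_ord_recl /= mul1r subn0.
by rewrite big1 ?addr0 // => i _; rewrite mul0r.
Qed.

Lemma fps_mulDl : left_distributive fps_mul fps_add.
Proof.
move=> f g h; apply: fpsP => n /=; rewrite -big_split /=.
by apply: eq_bigr => i _; rewrite mulrDl.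
Qed.

Lemma fps_one_neq0 : fps_one != 0.
Proof.
apply/eqP => /(congr1 (fun f => coeffs f 0)) /= /eqP.
by rewrite (oner_eq0 R).
Qed.

HB.instance Definition _ := GRing.Zmodule_isComNzRing.Build (fps R)
  fps_mulA fps_mulC fps_mul1 fps_mulDl fps_one_neq0.

Lemma coeffs0 n : coeffs (0 : fps R) n = 0. Proof. by []. Qed.
Lemma coeffs1 n : coeffs (1 : fps R) n = (n == 0%N)%:R. Proof. by []. Qed.
Lemma coeffsD f g n : coeffs (f + g) n = coeffs f n + coeffs g n.
Proof. by []. Qed.
Lemma coeffsN f n : coeffs (- f) n = - coeffs f n. Proof. by []. Qed.
Lemma coeffsM f g n :
  coeffs (f * g) n = \sum_(j < n.+1) coeffs f j * coeffs g (n - j).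
Proof. by []. Qed.

Lemma coeffs_sum (I : Type) (r : seq I) (P : pred I) (F : I -> fps R) n :
  coeffs (\sum_(i <- r | P i) F i) n = \sum_(i <- r | P i) coeffs (F i) n.
Proof. by elim/big_ind2: _ => // x1 x2 y1 y2 <- <-. Qed.

Definition fpsC (c : R) : fps R := FPS (fun n => if n == 0%N then c else 0).
Definition fpsX : fps R := FPS (fun n => (n == 1%N)%:R).

Lemma coeffsCM c f n : coeffs (fpsC c * f) n = c * coeffs f n.
Proof.
rewrite coeffsM big_ord_recl /= subn0 big1 ?addr0 // => i _.
by rewrite mul0r.
Qed.

Lemma coeffs_expr_eq0 h k n : coeffs h 0 = 0 -> (n < k)%N ->
  coeffs (h ^+ k) n = 0.
Proof.
move=> h0; elim: k n => // k IHk n ltnk.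
rewrite exprS coeffsM big_ord_recl h0 mul0r add0r big1 // => i _.
rewrite IHk ?mulr0 //= /bump /= add1n.
case: n i ltnk => [[]|n] // i; rewrite ltnS subSS => ltnk.
exact: leq_ltn_trans (leq_subr _ _) ltnk.
Qed.

Definition fps_unit : {pred fps R} := fun f => coeffs f 0 \is a GRing.unit.

(* Geometric series: f = c * (1 - h) with c = f(0) and h(0) = 0. *)
Definition fps_inv f : fps R :=
  if coeffs f 0 \is a GRing.unit then
    let h := 1 - fpsC (coeffs f 0)^-1 * f in
    FPS (fun n => (coeffs f 0)^-1 * coeffs (\sum_(k < n.+1) h ^+ k) n)
  else f.

Lemma fps_mulVr : {in fps_unit, left_inverse 1 fps_inv *%R}.
Proof.
move=> f uf; have {}uf : coeffs f 0 \is a GRing.unit by [].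
rewrite /fps_inv uf; set c := coeffs f 0; set h := 1 - _.
have h0 : coeffs h 0 = 0.
  by rewrite coeffsD coeffsN coeffsCM coeffs1 mulVr // subrr.
apply: fpsP => n.
transitivity (coeffs ((\sum_(k < n.+1) h ^+ k) * (fpsC c^-1 * f)) n).
  rewrite 2!coeffsM; apply: eq_bigr => i _.
  rewrite coeffsCM mulrCA mulrA; congr (_ * _ * _).
  have lein : (i.+1 <= n.+1)%N by rewrite ltn_ord.
  rewrite !coeffs_sum (big_ord_widen n.+1 (fun k => coeffs (h ^+ k) i)) //.
  rewrite big_mkcond; apply: eq_bigr => k _.
  by case: ltnP => // ltik; rewrite coeffs_expr_eq0.
have -> : fpsC c^-1 * f = - (h - 1) by rewrite /h opprB subKr.
rewrite mulrN mulrC -subrX1 opprB coeffsD coeffsN.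
by rewrite coeffs_expr_eq0 // subr0.
Qed.

Lemma fps_unitPl f g : g * f = 1 -> fps_unit f.
Proof.
move=> /(congr1 (fun f => coeffs f 0)); rewrite coeffsM big_ord1 subnn coeffs1.
move=> gf; rewrite /fps_unit; apply/unitrPr.
by exists (coeffs g 0); rewrite mulrC gf.
Qed.

Lemma fps_inv_out : {in [predC fps_unit], fps_inv =1 id}.
Proof.
move=> f nuf; rewrite /fps_inv ifN //.
Qed.

HB.instance Definition _ := GRing.ComNzRing_hasMulInverse.Build (fps R)
  fps_mulVr fps_unitPl fps_inv_out.

(* Sum of a family of series in which each coefficient receives only finitely
   many nonzero contributions. *)
Definition fps_sum (F : nat -> fps R) : fps R :=
  FPS (fun N => \sum_(n \in [set: nat]) coeffs (F n) N).

End FPS.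

Definition qpoch (R : comUnitRingType) (b q : R) (n : nat) : R :=
  \prod_(0 <= k < n) (1 - b * q ^+ k).

Definition lambda_term (n : nat) : fps int :=
  let q := fpsX int in
  (-1) ^+ n * q ^+ n * qpoch q (q ^+ 2) n / qpoch (- q) q n.

Definition mock_lambda : fps int := fps_sum lambda_term.

(* The division above is a genuine one, and [fps_sum] a genuine sum. *)
Lemma qpoch_unit n : qpoch (- fpsX int) (fpsX int) n \is a GRing.unit.
Proof.
rewrite /qpoch; elim/big_ind: _ => [|x y ux uy|k _].
- exact: unitr1.
- by rewrite unitrM ux.
- rewrite unfold_in /= /fps_unit coeffsD coeffsN mulNr coeffsN opprK.
  by rewrite coeffsM big_ord1 /= mul0r addr0 unitr1.
Qed.

Lemma coeffs_lambda_term_eq0 n N : (N < n)%N -> coeffs (lambda_term n) N = 0.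
Proof.
move=> ltNn; rewrite /lambda_term -!mulrA mulrCA coeffsM big1 // => i _.
by rewrite coeffs_expr_eq0 ?mul0r // (leq_ltn_trans _ ltNn) // -ltnS.
Qed.

Definition extend_by0 (a : nat -> int) (m : int) : int :=
  if m is Posz n then a n else 0.

Definition P_lambda : int -> int := extend_by0 (coeffs mock_lambda).

(* A partition of n into distinct parts in two colours is a set of coloured
   parts; the pair (i, c) stands for the part i + 1 <= n in colour c. *)
Definition p_2d_nat (n : nat) : nat :=
  #|[set A : {set 'I_n * bool} | (\sum_(x in A) x.1.+1)%N == n]|.

Definition p_2d : int -> int := extend_by0 (fun n => (p_2d_nat n)%:Z).

(* Main.v *)
Require Import Defs.
From mathcomp Require Import all_boot all_order all_algebra.
From mathcomp Require Import finmap boolp classical_sets functions cardinality fsbigop.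
From mathcomp Require Import zify ring.

Set Implicit Arguments.
Unset Strict Implicit.
Unset Printing Implicit Defensive.
Import Order.TTheory GRing.Theory Num.Theory.
Local Open Scope ring_scope.

(** Write J_k for the product (q^k; q^k)_oo, phi for the sum of (-1)^n q^(n^2)
    over all integers n, and psi for the sum of q^(n(n+1)/2) over n >= 0, so that
    phi = J_1^2 / J_2 and psi = J_2^2 / J_1. Since J_1^3 is the sum of
    (-1)^m (2m+1) q^(m(m+1)/2) and p_2d has generating series (J_2 / J_1)^2, the
    theorem is the coefficientwise reading of [lambda64_prod]: the series of the
    P_lambda(6n+4), multiplied by J_1^3, is 6 (J_2 / J_1)^2 J_6^3 phi(q^3).

    Although lambda is a mock theta function, its even part is a theta quotient.
    The product (q; q^2)_j psi is the sum over i >= 0 of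
    q^(i(i+1)/2) (1 - q^(i+1)) ... (1 - q^(i+2j)), and collecting the terms of
    lambda psi along r = i + j gives a Hecke-type series [mock_lambda_hecke]: the
    sum over r >= 0 and |j| <= r of (-1)^(r+j) q^(3r(r+1)/2 - j^2). Multiply it by
    phi and group the factors q^((m-j)^2 - j^2) = q^(m^2 - 2mj) by m. For m = 0 one
    finds J_3^3. For m <> 0 the sum over j is geometric, and up to the factor
    1 - q^(2m) there remains a bilateral theta series, which is either 0 or an odd
    power of q times J_1, up to sign [fiber_sum_odd]. As phi psi = J_1 J_2, the
    series lambda J_2 - J_3^3 / J_1 is odd. Up to factors in q^2, J_3^3 / J_1 is the
    product phi(q^3) f(q, q^5) of two theta series, whose even part is J_4^2 by a
    change of variables in the plane lattice. So the series of the P_lambda(2n) is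
    psi phi(q^3) / phi [lambda_evenE].

    It remains to keep the exponents congruent to 2 modulo 3. With
    Om = f(-q, -q^5) and A = f(q, q^2), one has phi = phi(q^9) - 2 q Om(q^3) and
    psi = A(q^3) + q psi(q^9), and A Om = phi(q^3) psi(q^3). Rationalizing the
    denominator phi by its conjugates under q -> w q, for a cube root of unity w,
    makes it a series in q^3, which is evaluated by comparing the norm of phi
    computed from J_1^2 / J_2 with that of its dissection [phi_cubic]. In the
    numerator the wanted terms are 4 A Om^2 and 2 psi(q^3) phi(q^3) Om, taken at
    q^3; they add up to 6 psi(q^3) phi(q^3) Om, hence the factor 6
    [lambda64_phi].

    The product formulas all come from Jacobi's triple product; like the series of
    J_1^3, it is the limit of a finite consequence of the q-binomial theorem. *)

Notation q := (fpsX int).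
Notation ser := (fps int).

(** * Coefficients *)

Lemma coeffsXM (f : ser) n :
  coeffs (q * f) n = if n is m.+1 then coeffs f m else 0.
Proof.
rewrite coeffsM big_ord_recl /= mul0r add0r; case: n => [|n]; first by rewrite big_ord0.
rewrite big_ord_recl /= mul1r subSS subn0 big1 ?addr0 // => i _.
by rewrite /bump /= mul0r.
Qed.

Lemma coeffsXnM e (f : ser) n :
  coeffs (q ^+ e * f) n = if (e <= n)%N then coeffs f (n - e) else 0.
Proof.
elim: e n => [|e IHe] n; first by rewrite expr0 mul1r subn0.
by rewrite exprS -mulrA coeffsXM; case: n => // n; rewrite IHe subSS ltnS.
Qed.

Lemma coeffsXn e n : coeffs (q ^+ e) n = (n == e)%:R.
Proof.
rewrite -[q ^+ e]mulr1 coeffsXnM coeffs1.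
case: leqP => [le_en|lt_ne]; last by case: eqP => // ne; lia.
by rewrite subn_eq0 eqn_leq le_en andbT.
Qed.

Lemma intr_fpsC (c : int) : c%:~R = fpsC c.
Proof.
have natC (m : nat) : (m%:R : ser) = fpsC m%:Z.
  elim: m => [|m IHm]; apply: fpsP => n /=; first by case: (n == 0)%N.
  rewrite -addn1 natrD IHm coeffsD coeffs1 /=.
  by case: (n == 0)%N; rewrite ?addr0 // addn1 -natrD addn1.
case: c => m; first exact: natC.
rewrite NegzE mulrNz; apply: fpsP => n.
by rewrite coeffsN -pmulrn natC /=; case: (n == 0)%N; rewrite ?oppr0.
Qed.

Lemma coeffs_intM (c : int) (f : ser) n : coeffs (c%:~R * f) n = c * coeffs f n.
Proof. by rewrite intr_fpsC coeffsCM. Qed.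

Lemma coeffs0M (f g : ser) : coeffs (f * g) 0 = coeffs f 0 * coeffs g 0.
Proof. by rewrite coeffsM big_ord1. Qed.

Lemma coeffs0_exp (f : ser) n : coeffs (f ^+ n) 0 = coeffs f 0 ^+ n.
Proof. by elim: n => // n IHn; rewrite !exprS coeffs0M IHn. Qed.

(** All the series divided by below have constant term 1. *)
Lemma coeffs0_unit (f : ser) : coeffs f 0 = 1 -> f \is a GRing.unit.
Proof. by move=> f0; rewrite unfold_in /= /fps_unit f0 unitr1. Qed.

(** * Congruence modulo a power of q *)

Definition eqX N (f g : ser) := forall i, (i < N)%N -> coeffs f i = coeffs g i.

Lemma eqX_refl N f : eqX N f f. Proof. by []. Qed.
Lemma eqX_sym N f g : eqX N f g -> eqX N g f.
Proof. by move=> fg i ltiN; rewrite fg. Qed.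
Lemma eqX_trans N g f h : eqX N f g -> eqX N g h -> eqX N f h.
Proof. by move=> fg gh i ltiN; rewrite fg ?gh. Qed.
Lemma eqX_le M N f g : (M <= N)%N -> eqX N f g -> eqX M f g.
Proof. by move=> leMN fg i ltiM; apply: fg; apply: leq_trans leMN. Qed.
Lemma eqXD N f f' g g' : eqX N f f' -> eqX N g g' -> eqX N (f + g) (f' + g').
Proof. by move=> ff gg i ltiN; rewrite !coeffsD ff ?gg. Qed.
Lemma eqXM N f f' g g' : eqX N f f' -> eqX N g g' -> eqX N (f * g) (f' * g').
Proof.
move=> ff gg i ltiN; rewrite !coeffsM; apply: eq_bigr => j _.
by rewrite ff ?gg // (leq_ltn_trans _ ltiN) ?leq_subr // -ltnS.
Qed.
Lemma eqX_sum N (I : Type) (r : seq I) (P : pred I) (F G : I -> ser) :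
  (forall i, P i -> eqX N (F i) (G i)) ->
  eqX N (\sum_(i <- r | P i) F i) (\sum_(i <- r | P i) G i).
Proof. by move=> FG; elim/big_ind2: _ => // *; apply: eqXD. Qed.
Lemma eqX_prod N (I : Type) (r : seq I) (P : pred I) (F G : I -> ser) :
  (forall i, P i -> eqX N (F i) (G i)) ->
  eqX N (\prod_(i <- r | P i) F i) (\prod_(i <- r | P i) G i).
Proof. by move=> FG; elim/big_ind2: _ => // *; apply: eqXM. Qed.
Lemma eqXP f g : (forall N, eqX N f g) -> f = g.
Proof. by move=> fg; apply: fpsP => n; apply: (fg n.+1). Qed.
Lemma eqX_cancel N u f g : u \is a GRing.unit -> eqX N (u * f) (u * g) -> eqX N f g.
Proof.
move=> uu ufg; rewrite -[f](mulKr uu) -[g](mulKr uu).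
exact: eqXM.
Qed.
Lemma eqX_Xn0 N e f : (N <= e)%N -> eqX N (q ^+ e * f) 0.
Proof. by move=> leNe i ltiN; rewrite coeffsXnM coeffs0 ifN // -ltnNge;
  apply: leq_trans leNe. Qed.

(** * Sums over an arbitrary index set *)

(** The summation [fps_sum], over an arbitrary index type. *)
Definition gsum (T : choiceType) (F : T -> ser) : ser :=
  FPS (fun N => \sum_(i \in [set: T]) coeffs (F i) N).

Definition summable (T : choiceType) (F : T -> ser) :=
  forall N, finite_set [set i | coeffs (F i) N <> 0].

Section Gsum.
Variable T : choiceType.
Implicit Types F G : T -> ser.

Lemma summable_fset F N : summable F ->
  exists A : {fset T}, forall i n, i \notin A -> (n < N)%N -> coeffs (F i) n = 0.
Proof.
move=> sF; pose B := (\bigcup_(n in `I_N) [set i | coeffs (F i) n <> 0])%classic.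
have fB : finite_set B by apply: bigcup_finite => // n _; apply: sF.
exists (fset_set B) => i n; rewrite in_fset_set // => nBi ltnN.
apply: contrapT => nz; move: nBi; rewrite notin_setE; apply.
by exists n.
Qed.

Lemma coeffs_gsum F (A : {fset T}) N :
  (forall i, i \notin A -> coeffs (F i) N = 0) ->
  coeffs (gsum F) N = coeffs (\sum_(i <- A) F i) N.
Proof. by move=> nA; rewrite /= (@fsbigTE _ _ _ _ A) // coeffs_sum. Qed.

Lemma eq_gsum F G : (forall i, F i = G i) -> gsum F = gsum G.
Proof. by move=> FG; congr gsum; apply/funext. Qed.

Lemma gsumMl (f : ser) F : summable F -> f * gsum F = gsum (fun i => f * F i).
Proof.
move=> sF; apply: fpsP => N; have [A An] := summable_fset N.+1 sF.
rewrite (coeffs_gsum (A := A)) => [|i nAi].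
  rewrite -mulr_sumr; apply: (@eqXM N.+1) (ltnSn N) => // n ltnN.
  by rewrite (coeffs_gsum (A := A)) // => i nAi; apply: An.
rewrite coeffsM big1 // => j _; rewrite (An i (N - j)%N nAi) ?mulr0 //.
by rewrite ltnS leq_subr.
Qed.

Lemma gsumD F G : summable F -> summable G ->
  gsum (fun i => F i + G i) = gsum F + gsum G.
Proof.
move=> sF sG; apply: fpsP => N; rewrite coeffsD.
have [A An] := summable_fset N.+1 sF; have [B Bn] := summable_fset N.+1 sG.
rewrite !(coeffs_gsum (A := (A `|` B)%fset)) => [|i|i|i]; first by rewrite big_split.
- by rewrite in_fsetU negb_or => /andP[_ nB]; apply: Bn.
- by rewrite in_fsetU negb_or => /andP[nA _]; apply: An.
rewrite in_fsetU negb_or coeffsD => /andP[nA nB].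
by rewrite An // Bn.
Qed.

End Gsum.

Lemma gsum_reindex (T U : choiceType) (h : T -> U) (F : U -> ser) :
  bijective h -> gsum F = gsum (fun i => F (h i)).
Proof. by move=> bh; apply: fpsP => N; apply: reindex_fsbigT. Qed.

Lemma summable_box (T U : choiceType) (G : T -> U -> ser) N :
  summable (fun p : T * U => G p.1 p.2) ->
  exists B : set T, exists C : set U, [/\ finite_set B, finite_set C,
    forall i j, ~ B i -> coeffs (G i j) N = 0 &
    forall i j, ~ C j -> coeffs (G i j) N = 0].
Proof.
move=> /(_ N); set A := (X in finite_set X) => fA.
exists (fst @` A)%classic, (snd @` A)%classic; split; try exact: finite_image.
  by move=> i j nB; apply: contrapT => nz; apply: nB; exists (i, j).
by move=> i j nB; apply: contrapT => nz; apply: nB; exists (i, j).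
Qed.

Lemma coeffs_gsum2 (T U : choiceType) (G : T -> U -> ser) N (B : set T) (C : set U) :
  (forall i j, ~ B i -> coeffs (G i j) N = 0) ->
  (forall i j, ~ C j -> coeffs (G i j) N = 0) ->
  coeffs (gsum (fun i => gsum (G i))) N =
  \sum_(i \in B) \sum_(j \in C) coeffs (G i j) N.
Proof.
move=> B0 C0 /=; rewrite -(fsbig_widen B [set: T]) //; last first.
  by move=> i [_ nB] /=; apply: fsbig1 => j _; apply: B0.
apply: eq_fsbigr => i _.
by rewrite -(fsbig_widen C [set: U]) // => j [_ nC]; apply: C0.
Qed.

Lemma gsum_pair (T U : choiceType) (G : T -> U -> ser) :
  summable (fun p : T * U => G p.1 p.2) ->
  gsum (fun i => gsum (G i)) = gsum (fun p : T * U => G p.1 p.2).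
Proof.
move=> sG; apply: fpsP => N; have [B [C [fB fC B0 C0]]] := summable_box N sG.
rewrite (coeffs_gsum2 B0 C0) pair_fsbig //.
apply: fsbig_widen => // -[i j] [_ /= nBC]; apply: contrapT => nz; apply: nBC.
by split; apply: contrapT => nB; apply: nz; [apply: B0|apply: C0].
Qed.

Lemma gsum_exchange (T U : choiceType) (G : T -> U -> ser) :
  summable (fun p : T * U => G p.1 p.2) ->
  gsum (fun i => gsum (G i)) = gsum (fun j => gsum (fun i => G i j)).
Proof.
move=> sG; apply: fpsP => N; have [B [C [fB fC B0 C0]]] := summable_box N sG.
rewrite (coeffs_gsum2 B0 C0) exchange_fsbig //.
by rewrite (coeffs_gsum2 (G := fun j i => G i j) (B := C) (C := B)) // => i j;
  [apply: C0 | apply: B0].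
Qed.

(** * Sums of signed powers of q *)

Definition mono (c e : int) : ser := FPS (fun n => if e == n%:Z then c else 0).

Lemma mono_nat c (e : nat) : mono c e = c%:~R * q ^+ e.
Proof.
apply: fpsP => n; rewrite coeffs_intM coeffsXn /= eqz_nat eq_sym.
by case: eqP; rewrite ?mulr1 ?mulr0.
Qed.

Lemma monoE c (e : int) : 0 <= e -> mono c e = c%:~R * q ^+ `|e|%N.
Proof. by case: e => // e _; rewrite mono_nat. Qed.

Lemma mono_mul c c' (e e' : int) : 0 <= e -> 0 <= e' ->
  mono c e * mono c' e' = mono (c * c') (e + e').
Proof.
move=> e0 e0'; rewrite !monoE ?addr_ge0 // intrM.
have -> : absz (e + e') = (absz e + absz e')%N by lia.
by rewrite exprD; ring.
Qed.

Definition qs (T : choiceType) (c e : T -> int) : ser := gsum (fun i => mono (c i) (e i)).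

(** The finiteness of the sublevel sets makes every coefficient of [qs c e] a finite
    sum; negative exponents, which [mono] discards, are excluded so that exponents
    may be added and rescaled. *)
Definition tame (T : choiceType) (e : T -> int) :=
  (forall i, 0 <= e i) /\ forall N : nat, finite_set [set i | e i <= N%:Z].

Lemma summable_mono (T : choiceType) (c e : T -> int) :
  tame e -> summable (fun i => mono (c i) (e i)).
Proof.
move=> [_ fe] N; apply: sub_finite_set (fe N) => i /=.
by case: eqP => [->|].
Qed.

Lemma eq_qs (T : choiceType) (c c' e e' : T -> int) :
  (forall i, c i = c' i) -> (forall i, e i = e' i) -> qs c e = qs c' e'.
Proof. by move=> cc ee; apply: eq_gsum => i; rewrite cc ee. Qed.

Lemma qs_reindex (T U : choiceType) (h : T -> U) (c e : U -> int) (c' e' : T -> int) :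
  bijective h -> (forall i, c (h i) = c' i) -> (forall i, e (h i) = e' i) ->
  qs c e = qs c' e'.
Proof.
by move=> bh cc ee; rewrite /qs (gsum_reindex _ bh); apply: eq_gsum => i; rewrite cc ee.
Qed.

Lemma finite_int_bound (B : nat) : finite_set [set i : int | `|i| <= B%:Z].
Proof.
apply: (@sub_finite_set _ _ ((fun n : nat => n%:Z - B%:Z) @` `I_(2 * B).+1)%classic).
  by move=> i /= iB; exists (absz (i + B%:Z)); lia.
by apply: finite_image; exact: finite_II.
Qed.

Lemma tame_int (e : int -> int) (C : nat) :
  (forall i, 0 <= e i) -> (forall i, `|i| <= e i + C%:Z) -> tame e.
Proof.
move=> e0 eC; split=> // N; apply: sub_finite_set (finite_int_bound (N + C)).
by move=> i /= eN; have := eC i; lia.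
Qed.

Lemma tame_nat (e : nat -> int) : (forall i : nat, i%:Z <= e i) -> tame e.
Proof.
move=> ei; split=> [i|N]; first by apply: le_trans (ei i).
apply: (@sub_finite_set _ _ `I_N.+1); last exact: finite_II.
by move=> i /= eN; have := ei i; lia.
Qed.

Lemma tame_pair (T U : choiceType) (e : T -> int) (f : U -> int) :
  tame e -> tame f -> tame (fun p : T * U => e p.1 + f p.2).
Proof.
move=> [e0 fe] [f0 ff]; split=> [p|N]; first exact: addr_ge0.
apply: (sub_finite_set _ (finite_setX (fe N) (ff N))) => -[i j] /= ef.
by have := e0 i; have := f0 j; split=> /=; lia.
Qed.

Lemma mulr_qs (T : choiceType) (f : ser) (c e : T -> int) : tame e ->
  f * qs c e = gsum (fun i => f * mono (c i) (e i)).
Proof. by move=> pe; rewrite gsumMl //; apply: summable_mono. Qed.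

Lemma qs_mul (T U : choiceType) (c e : T -> int) (d f : U -> int) :
  tame e -> tame f ->
  qs c e * qs d f = qs (fun p : T * U => c p.1 * d p.2) (fun p => e p.1 + f p.2).
Proof.
move=> pe pf; rewrite mulrC mulr_qs //.
transitivity (gsum (fun i => gsum (fun j => mono (c i * d j) (e i + f j)))).
  apply: eq_gsum => i; rewrite mulrC mulr_qs //; apply: eq_gsum => j.
  by rewrite mono_mul //; [case: pe | case: pf].
by rewrite gsum_pair //; apply: summable_mono; apply: tame_pair.
Qed.

Lemma qs_shift (T : choiceType) (k : nat) (c e : T -> int) : tame e ->
  qs c (fun i => e i + k%:Z) = q ^+ k * qs c e.
Proof.
move=> pe; rewrite mulr_qs //; apply: eq_gsum => i.
by rewrite -[q ^+ k]mul1r -(mono_nat 1) mono_mul ?mul1r ?[_ + e i]addrC //; case: pe.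
Qed.

Lemma qs_const (T : choiceType) (a : int) (c e : T -> int) : tame e ->
  qs (fun i => a * c i) e = a%:~R * qs c e.
Proof.
move=> pe; rewrite mulr_qs //; apply: eq_gsum => i.
by case: pe => e0 _; rewrite !monoE // intrM mulrA.
Qed.

Lemma coeffs_mono_mul c (e : int) (f : ser) (n : nat) : 0 <= e ->
  coeffs (f * mono c e) n = c * extend_by0 (coeffs f) (n%:Z - e).
Proof.
case: e => // e _; rewrite mono_nat mulrCA coeffs_intM mulrC [in RHS]mulrC; congr (_ * _).
rewrite mulrC coeffsXnM; case: leqP => le_en.
  by have -> : n%:Z - e%:Z = (n - e)%N%:Z by lia.
by rewrite /extend_by0; have [m ->] : exists m, n%:Z - e%:Z = Negz m by exists (e - n).-1; lia.
Qed.

Lemma coeffs_mul_qs (T : choiceType) (c e : T -> int) (f : ser) (n : nat) : tame e ->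
  coeffs (f * qs c e) n = \sum_(i \in [set: T]) c i * extend_by0 (coeffs f) (n%:Z - e i).
Proof.
move=> pe; rewrite mulr_qs //; apply: eq_fsbigr => i _.
by rewrite coeffs_mono_mul //; case: pe.
Qed.


(** * Infinite products *)

Definition iprod (F : nat -> ser) : ser :=
  FPS (fun N => coeffs (\prod_(m < N.+1) F m) N).

Definition near1 (F : nat -> ser) := forall m, eqX m.+1 (F m) 1.

Lemma eqX_prod_tail F N M : near1 F -> (N <= M)%N ->
  eqX N (\prod_(m < N) F m) (\prod_(m < M) F m).
Proof.
move=> F1; elim: M => [|M IHM]; first by rewrite leqn0 => /eqP->.
rewrite leq_eqVlt => /orP[/eqP-> //|]; rewrite ltnS => leNM.
rewrite big_ord_recr /= -[X in eqX _ X _]mulr1; apply: eqXM; first exact: IHM.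
by apply: eqX_sym; apply: eqX_le (F1 M); apply: leqW.
Qed.

Lemma iprodP F N M : near1 F -> (N <= M)%N -> eqX N (iprod F) (\prod_(m < M) F m).
Proof.
move=> F1 leNM i ltiN /=.
by apply: (eqX_prod_tail F1) => //; apply: leq_trans leNM.
Qed.

Lemma iprod_unique F f : near1 F -> (forall N, exists2 M, (N <= M)%N & eqX N f (\prod_(m < M)
  F m)) ->
  f = iprod F.
Proof.
move=> F1 fF; apply: eqXP => N; have [M leNM fM] := fF N.
by apply: eqX_trans fM _; apply: eqX_sym; apply: iprodP.
Qed.

Lemma near1M F G : near1 F -> near1 G -> near1 (fun m => F m * G m).
Proof. by move=> F1 G1 m; rewrite -[1]mulr1; apply: eqXM. Qed.

Lemma iprodM F G : near1 F -> near1 G -> iprod F * iprod G = iprod (fun m => F m * G m).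
Proof.
move=> F1 G1; apply: iprod_unique => [|N]; first exact: near1M.
by exists N => //; rewrite big_split; apply: eqXM; apply: iprodP.
Qed.

Lemma iprod_blocks k F : (0 < k)%N -> near1 F ->
  iprod F = \prod_(i < k) iprod (fun m => F (i + k * m)%N).
Proof.
move=> k0 F1.
have F1i i : near1 (fun m => F (i + k * m)%N).
  by move=> m; apply: eqX_le (F1 _); rewrite ltnS; nia.
apply: eqXP => N; apply: (eqX_trans (g := \prod_(m < N * k) F m)).
  by apply: iprodP => //; nia.
apply: (eqX_trans (g := \prod_(i < k) \prod_(m < N) F (i + k * m)%N)); last first.
  by apply: eqX_prod => i _; apply: eqX_sym; apply: iprodP.
rewrite exchange_big /= => i ltiN; congr (coeffs _ i).
elim: N {i ltiN} => [|N IHN]; first by rewrite !big_ord0.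
rewrite mulSnr big_split_ord IHN big_ord_recr /=; congr (_ * _).
by apply: eq_bigr => i _; rewrite mulnC addnC.
Qed.

(** The product (s q^a; q^b)_oo. It is locked so that products with distinct
    parameters are told apart by these parameters, without being unfolded. *)
Definition qp : int -> nat -> nat -> ser :=
  locked (fun s a b => iprod (fun m => 1 - s%:~R * q ^+ (a + b * m))).

Lemma qpE s a b : qp s a b = iprod (fun m => 1 - s%:~R * q ^+ (a + b * m)).
Proof. by rewrite /qp -lock. Qed.

Lemma qp_near1 s a b : (0 < a)%N -> (0 < b)%N ->
  near1 (fun m => 1 - s%:~R * q ^+ (a + b * m)).
Proof.
move=> a0 b0 m i ltim; rewrite coeffsD coeffsN coeffs_intM coeffsXn.
by case: eqP => [?|_]; [nia | rewrite mulr0 subr0].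
Qed.

Lemma coeffs0_qp s a b : (0 < a)%N -> (0 < b)%N -> coeffs (qp s a b) 0 = 1.
Proof.
by move=> a0 b0; rewrite qpE /= big_ord1; apply: (qp_near1 s a0 b0).
Qed.

Lemma qp_unit s a b : (0 < a)%N -> (0 < b)%N -> qp s a b \is a GRing.unit.
Proof. by move=> a0 b0; apply: coeffs0_unit; apply: coeffs0_qp. Qed.

Lemma qp_blocks k s a b : (0 < a)%N -> (0 < b)%N -> (0 < k)%N ->
  qp s a b = \prod_(i < k) qp s (a + i * b) (k * b).
Proof.
move=> a0 b0 k0; rewrite qpE (iprod_blocks k0); last exact: qp_near1.
apply: eq_bigr => i _; rewrite qpE; congr iprod; apply/funext => m.
by congr (1 - _ * q ^+ _); ring.
Qed.

Lemma qp_conj a b : (0 < a)%N -> (0 < b)%N ->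
  qp 1 a b * qp (-1) a b = qp 1 (2 * a) (2 * b).
Proof.
move=> a0 b0; rewrite !qpE iprodM; [|exact: qp_near1|exact: qp_near1]; congr iprod;
  apply/funext => m.
have -> : (2 * a + 2 * b * m = (a + b * m) * 2)%N by ring.
by rewrite exprM; ring.
Qed.

(** * Gaussian binomial coefficients *)

Section GaussBinomial.
Variables (R : comNzRingType) (Q : R).

Fixpoint gbin (n k : nat) : R :=
  match n, k with
  | _, 0 => 1
  | 0, _.+1 => 0
  | n'.+1, k'.+1 => gbin n' k' + Q ^+ k'.+1 * gbin n' k'.+1
  end.

Lemma gbinn0 n : gbin n 0 = 1. Proof. by case: n. Qed.

Lemma gbinS n k : gbin n.+1 k.+1 = gbin n k + Q ^+ k.+1 * gbin n k.+1.
Proof. by []. Qed.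

Lemma gbin_small n k : (n < k)%N -> gbin n k = 0.
Proof.
elim: n k => [|n IHn] [|k] //= ltnk.
by rewrite !IHn ?mulr0 ?addr0 // ltnW.
Qed.

Definition qfact (n : nat) : R := \prod_(i < n) (1 - Q ^+ i.+1).

Lemma qfactS n : qfact n.+1 = qfact n * (1 - Q ^+ n.+1).
Proof. exact: big_ord_recr. Qed.

Lemma gbin_fact m k : gbin (m + k) k * qfact k * qfact m = qfact (m + k).
Proof.
have [n] := ubnP (m + k); elim: n m k => // n IHn m [|k] lt_n.
  by rewrite gbinn0 addn0 /qfact big_ord0 !mul1r.
have Ek : gbin (m + k) k * qfact k * qfact m = qfact (m + k) by apply: IHn; lia.
rewrite addnS /=; case: m => [|m] in lt_n Ek *.
  by rewrite (gbin_small (ltnSn _)) mulr0 addr0 !qfactS -[in RHS]Ek; ring.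
have Em : gbin (m + k.+1) k.+1 * qfact k.+1 * qfact m = qfact (m + k.+1) by apply: IHn; lia.
move: Em; rewrite addnS -addSn => Em.
transitivity (qfact (m.+1 + k) * (1 - Q ^+ k.+1)
              + Q ^+ k.+1 * qfact (m.+1 + k) * (1 - Q ^+ m.+1)).
  by rewrite -{1}Ek -Em !qfactS; ring.
by rewrite [RHS]qfactS -addnS addnC exprD; ring.
Qed.

(** Splitting off the factor k = 0 replaces v by v Q in the others, which is the
    recursion defining [gbin]. *)
Lemma gauss_binomial (u v : R) n :
  \prod_(k < n) (u + v * Q ^+ k) =
  \sum_(k < n.+1) gbin n k * Q ^+ 'C(k, 2) * u ^+ (n - k) * v ^+ k.
Proof.
elim: n v => [|n IHn] v; first by rewrite big_ord0 big_ord1 /= !mulr1.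
rewrite big_ord_recl expr0 mulr1.
under eq_bigr => i _ do rewrite lift0 exprS mulrA.
rewrite IHn mulrDl; set S := \sum_(k < n.+1) _.
have -> : u * S = \sum_(k < n.+2) gbin n k * Q ^+ 'C(k, 2) * Q ^+ k * u ^+ (n.+1 - k) * v ^+ k.
  rewrite [RHS]big_ord_recr /= gbin_small // !mul0r addr0 mulr_sumr.
  apply: eq_bigr => k _; rewrite subSn -1?ltnS // exprMn exprS; ring.
have -> : v * S = \sum_(k < n.+2) (if nat_of_ord k is k'.+1 then gbin n k' * Q ^+ 'C(k', 2) *
  Q ^+ k' * u ^+ (n - k') * v ^+ k else 0).
  rewrite [RHS]big_ord_recl add0r mulr_sumr.
  by apply: eq_bigr => k _; rewrite lift0 exprMn exprS; ring.
rewrite -big_split /=; apply: eq_bigr => -[[|k] ltk] _ /=.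
  by rewrite gbinn0 !mulr1 addr0.
by rewrite subSS binS bin1 exprD; ring.
Qed.

End GaussBinomial.
Arguments gbin : simpl never.


(** * Jacobi's triple product *)

Definition tri (j : int) : int := (j * (j + 1) %/ 2)%Z.

Lemma tri2 j : 2 * tri j = j * (j + 1).
Proof.
have tri_half k : j * (j + 1) = 2 * k -> 2 * tri j = j * (j + 1).
  by move=> e; rewrite /tri e mulKz.
have e : j = 2 * (j %/ 2)%Z + (j %% 2)%Z by lia.
have [r|r] : (j %% 2)%Z = 0 \/ (j %% 2)%Z = 1 by lia.
  by apply: (tri_half ((j %/ 2)%Z * (j + 1))); rewrite {1}e r; ring.
by apply: (tri_half (j * ((j %/ 2)%Z + 1))); rewrite {2}e r; ring.
Qed.

Lemma tri_ge0 j : 0 <= tri j.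
Proof. by have := tri2 j; nia. Qed.

Lemma tri_binS (n : nat) : tri n%:Z = 'C(n.+1, 2)%:Z.
Proof.
by have := tri2 n%:Z; have := mul_bin_diag n.+1 1; rewrite bin1 /=; nia.
Qed.

Lemma coeffs_qs_window (c e : int -> int) (h n N : nat) :
  (forall j, (j + h%:Z < 0) || (n%:Z < j + h%:Z) -> N%:Z < e j) ->
  eqX N.+1 (qs c e) (\sum_(k < n.+1) mono (c (k%:Z - h%:Z)) (e (k%:Z - h%:Z))).
Proof.
move=> out i ltiN; rewrite coeffs_sum.
pose r := [seq k%:Z - h%:Z | k <- iota 0 n.+1].
rewrite [LHS]/= (@fsbigE _ _ _ _ _ r) //.
- rewrite big_map -[iota _ _]/(index_iota 0 n.+1) big_mkord.
  by apply: eq_big => // k; apply: mem_set.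
- by rewrite map_inj_uniq ?iota_uniq // => x y; lia.
move=> j _ /mapP nj; have /out : (j + h%:Z < 0) || (n%:Z < j + h%:Z).
  apply: contrapT => /negP; rewrite negb_or -!leNgt => /andP[j0 jn]; apply: nj.
  by exists (absz (j + h%:Z)); rewrite ?mem_iota; lia.
by case: eqP => // ->; lia.
Qed.

Lemma qfact_lim d M n : (0 < d)%N -> (M <= n)%N -> eqX M (qfact (q ^+ d) n) (qp 1 d d).
Proof.
move=> d0 leMn; rewrite qpE; apply: eqX_sym; apply: eqX_trans (iprodP _ leMn) _;
  first exact: qp_near1.
rewrite /qfact; apply: eqX_prod => i _.
by rewrite -exprM mulnS mul1r.
Qed.

Lemma gbin_lim d M n k : (0 < d)%N -> (M <= k)%N -> (k + M <= n)%N ->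
  eqX M (qp 1 d d * gbin (q ^+ d) n k) 1.
Proof.
move=> d0 leMk leMn; have [m en] : exists m, n = (m + k)%N by exists (n - k)%N; lia.
have leMm : (M <= m)%N by lia.
apply: (@eqX_cancel M (qp 1 d d)); first exact: qp_unit.
have := gbin_fact (q ^+ d) m k; rewrite -en => E.
apply: (eqX_trans (g := gbin (q ^+ d) n k * qfact (q ^+ d) k * qfact (q ^+ d) m)).
  have -> : qp 1 d d * (qp 1 d d * gbin (q ^+ d) n k) = gbin (q ^+ d) n k * qp 1 d d * qp 1 d
    d by ring.
  by do 2?apply: eqXM => //; apply: eqX_sym; apply: qfact_lim.
by rewrite E mulr1; apply: qfact_lim => //; lia.
Qed.

(** A Gaussian binomial far from both ends of its row is close to the reciprocal of
    (q^d; q^d)_oo; the terms near the ends have large exponents. Here the index k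
    of the row stands for j = k - h. *)
Lemma gauss_limit (d C : nat) (c e : int -> int) (h n M : nat) : (0 < d)%N ->
  (forall j, `|j| <= e j + C%:Z) -> (2 * M + C < h)%N -> (h + h <= n + 1)%N ->
  eqX M (qp 1 d d * \sum_(k < n.+1) gbin (q ^+ d) n k * mono (c (k%:Z - h%:Z)) (e (k%:Z -
    h%:Z)))
    (qs c e).
Proof.
move=> d0 ej hM hn; apply: eqX_sym; apply: (eqX_trans (g := \sum_(k < n.+1) mono (c (k%:Z -
  h%:Z)) (e (k%:Z - h%:Z)))).
  apply: (@eqX_le M M.+1) => //; apply: coeffs_qs_window => j jo.
  by have := ej j; lia.
rewrite mulr_sumr; apply: eqX_sum => k _; rewrite mulrA.
have [inside|outside] := ltrP `|k%:Z - h%:Z| (M + C)%N%:Z.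
  rewrite -[X in eqX _ X _]mul1r; apply: eqXM => //; apply: eqX_sym.
  by apply: gbin_lim => //; lia.
have m0 : eqX M (mono (c (k%:Z - h%:Z)) (e (k%:Z - h%:Z))) 0.
  move=> i ltiM /=; case: eqP => // ee.
  by have := ej (k%:Z - h%:Z); rewrite ee; lia.
apply: (eqX_trans m0); rewrite -(mulr0 (qp 1 d d * gbin (q ^+ d) n k)).
by apply: eqXM (eqX_sym m0).
Qed.

(** Ramanujan's theta function f(x, y) at x = s q^a and y = s q^b, for a sign s. *)
Definition th (s : int) (a b : nat) : ser :=
  qs (fun j => s ^+ `|j|%N) (fun j => a%:Z * tri j + b%:Z * tri (- j)).

Lemma th_exp_ge (a b : nat) (j : int) : (0 < a)%N -> (0 < b)%N ->
  `|j| <= a%:Z * tri j + b%:Z * tri (- j).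
Proof.
move=> a0 b0; have := tri2 j; have := tri2 (- j).
have := tri_ge0 j; have := tri_ge0 (- j); nia.
Qed.

Lemma th_tame (a b : nat) : (0 < a)%N -> (0 < b)%N ->
  tame (fun j => a%:Z * tri j + b%:Z * tri (- j)).
Proof.
move=> a0 b0; apply: (@tame_int _ 0) => j; last by rewrite addr0 th_exp_ge.
by apply: le_trans (th_exp_ge j a0 b0).
Qed.

Lemma sqr_sign (s : int) n m : s ^+ 2 = 1 -> (n = m %[mod 2])%N -> s ^+ n = s ^+ m.
Proof.
move=> s2 nm; rewrite (divn_eq n 2) (divn_eq m 2) nm !exprD ![(_ * 2)%N]mulnC !exprM s2.
by rewrite !expr1n.
Qed.

Lemma prod_geometric (R : comNzRingType) (x Q : R) N :
  \prod_(i < N) (x * Q ^+ i) = x ^+ N * Q ^+ 'C(N, 2).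
Proof.
elim: N => [|N IHN]; first by rewrite big_ord0 !expr0 mulr1.
by rewrite big_ord_recr IHN /= binS bin1 exprD exprS; ring.
Qed.

Lemma Xn_inj e : injective (fun f : ser => q ^+ e * f).
Proof.
move=> f g fg; apply: fpsP => n.
have := congr1 (fun h => coeffs h (e + n)) fg.
by rewrite !coeffsXnM leq_addr addKn.
Qed.

Lemma bin2_int (n : nat) : 2 * 'C(n, 2)%:Z = n%:Z * (n%:Z - 1).
Proof. by case: n => [|n]; rewrite // -tri_binS tri2; lia. Qed.

(** The q-binomial theorem with u = q^((a+b)N) and v = s q^a pairs the factor of
    index N - 1 - i with 1 + s q^b q^((a+b)i), and the factor of index N + i with
    1 + s q^a q^((a+b)i). *)
Lemma finite_triple_product (s : int) (a b N : nat) : s ^+ 2 = 1 ->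
  (0 < a)%N -> (0 < b)%N ->
  (\prod_(i < N) (1 + s%:~R * q ^+ (b + (a + b) * i)))
  * \prod_(i < N) (1 + s%:~R * q ^+ (a + (a + b) * i))
  = \sum_(k < (2 * N).+1) gbin (q ^+ (a + b)) (2 * N) k *
      mono (s ^+ `|k%:Z - N%:Z|%N)
           (a%:Z * tri (k%:Z - N%:Z) + b%:Z * tri (- (k%:Z - N%:Z))).
Proof.
move=> s2 a0 b0; have ss : (s%:~R : ser) ^+ 2 = 1 by rewrite -rmorphXn s2.
set Q := q ^+ (a + b); pose x : ser := s%:~R * q ^+ a.
set PB := \prod_(i < N) _; set PA := \prod_(i < N) _.
pose E := (a * N + (a + b) * ('C(N, 2) + N * N))%N.
have lhs : \prod_(k < 2 * N) (Q ^+ N + x * Q ^+ k) = q ^+ E * (s%:~R ^+ N * (PB * PA)).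
  have hiE : \prod_(i < N) (Q ^+ N + x * Q ^+ (N + i)) = Q ^+ (N * N) * PA.
    rewrite exprM -[N in _ ^+ N * _]card_ord -prodr_const -big_split /=.
    apply: eq_bigr => i _; rewrite /x /Q !exprD !exprM !exprD; ring.
  have loE : \prod_(i < N) (Q ^+ N + x * Q ^+ i) = x ^+ N * Q ^+ 'C(N, 2) * PB.
    rewrite -prod_geometric /PB [in X in _ * X](reindex_inj rev_ord_inj) -big_split /=.
    apply: eq_bigr => i _; rewrite mulrDr mulr1 addrC; congr (_ + _).
    have eN : ((a + b) * N = a + (a + b) * i + (b + (a + b) * (N - i.+1)))%N.
      by have := ltn_ord i; nia.
    rewrite /Q -!exprM eN /x !exprD; set u := q ^+ (_ * (N - _)).
    transitivity (s%:~R ^+ 2 * q ^+ a * q ^+ ((a + b) * i) * q ^+ b * u); last by ring.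
    by rewrite ss; ring.
  rewrite mul2n -addnn big_split_ord /= hiE loE /x exprMn -!exprM /E mulnDr !exprD.
  by ring.
have := gauss_binomial Q (Q ^+ N) x (2 * N); rewrite lhs.
have -> : \sum_(k < (2 * N).+1) gbin Q (2 * N) k * Q ^+ 'C(k, 2) * (Q ^+ N) ^+ (2 * N - k) * x
  ^+ k =
  q ^+ E * (s%:~R ^+ N * \sum_(k < (2 * N).+1) gbin Q (2 * N) k *
      mono (s ^+ `|k%:Z - N%:Z|%N)
           (a%:Z * tri (k%:Z - N%:Z) + b%:Z * tri (- (k%:Z - N%:Z)))).
  rewrite !mulr_sumr; apply: eq_bigr => k _.
  set e := a%:Z * _ + _; have e0 : 0 <= e by apply: addr_ge0; rewrite mulr_ge0 ?tri_ge0.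
  rewrite monoE // rmorphXn /=.
  have -> : (s%:~R : ser) ^+ N * (gbin Q (2 * N) k * (s%:~R ^+ `|k%:Z - N%:Z|%N * q ^+
    `|e|%N)) =
     gbin Q (2 * N) k * (s%:~R ^+ k * q ^+ `|e|%N).
    have -> : (s%:~R : ser) ^+ k = s%:~R ^+ (N + `|k%:Z - N%:Z|)%N.
      by rewrite -!rmorphXn; congr (_%:~R); apply: sqr_sign => //; lia.
    by rewrite exprD; ring.
  have eE : (a * k + (a + b) * ('C(k, 2) + N * (2 * N - k)))%N = (E + absz e)%N.
    apply/eqP; rewrite -eqz_nat /E !(PoszD, PoszM) gez0_abs // /e.
    have := tri2 (k%:Z - N%:Z); have := tri2 (- (k%:Z - N%:Z)).
    have := bin2_int k; have := bin2_int N.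
    move: (tri (k%:Z - N%:Z)) (tri (- (k%:Z - N%:Z))) 'C(N, 2) 'C(k, 2) => T T' CN Ck h1 h2 h3
      h4.
    have kle : (k <= 2 * N)%N by rewrite -ltnS.
    have -> : T = T' + (k%:Z - N%:Z) by lia.
    have -> : T' = Ck%:Z - CN%:Z - N%:Z * (k%:Z - N%:Z) by lia.
    rewrite -subzn // PoszM; apply/eqP; ring.
  transitivity (gbin Q (2 * N) k * s%:~R ^+ k * q ^+ (E + absz e)).
    by rewrite -eE exprD mulnDr exprD /x /Q exprMn -!exprM; ring.
  by rewrite exprD; ring.
move=> /Xn_inj /(congr1 (fun f => s%:~R ^+ N * f)); rewrite !mulrA -!exprMn.
by rewrite -expr2 ss !expr1n !mul1r.
Qed.

(** The limit N -> oo of [finite_triple_product], times (q^(a+b); q^(a+b))_oo. *)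
Theorem jacobi_triple_product (s : int) (a b : nat) : s ^+ 2 = 1 ->
  (0 < a)%N -> (0 < b)%N ->
  th s a b = qp (- s) a (a + b) * qp (- s) b (a + b) * qp 1 (a + b) (a + b).
Proof.
move=> s2 a0 b0; have ab0 : (0 < a + b)%N by lia.
apply: eqXP => M; pose N := (2 * M).+1.
have hM : (2 * M + 0 < N)%N by rewrite /N; lia.
have hN : (N + N <= 2 * N + 1)%N by lia.
have ej j : `|j| <= a%:Z * tri j + b%:Z * tri (- j) + 0%N%:Z by rewrite addr0 th_exp_ge.
apply: eqX_trans (eqX_sym (@gauss_limit _ 0 (fun j => s ^+ `|j|%N) _ N (2 * N) M ab0 ej hM
  hN)) _.
rewrite -finite_triple_product // mulrC; apply: eqXM => //; rewrite mulrC.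
have prodE e : (0 < e)%N -> eqX M (\prod_(i < N) (1 + s%:~R * q ^+ (e + (a + b) * i))) (qp (-
  s) e (a + b)).
  move=> e0.
  have -> : \prod_(i < N) (1 + s%:~R * q ^+ (e + (a + b) * i)) =
      \prod_(i < N) (1 - (- s)%:~R * q ^+ (e + (a + b) * i)).
    by apply: eq_bigr => i _; rewrite rmorphN mulNr opprK.
  by rewrite qpE; apply: eqX_sym; apply: (iprodP (qp_near1 _ e0 ab0)); rewrite /N; lia.
by apply: eqXM; apply: prodE.
Qed.

(** * Jacobi's identity for the cube of Euler's product *)

Definition eul (k : nat) : ser := qp 1 k k.

Lemma gbin_polyC (R : comNzRingType) (Q : R) n k : gbin Q%:P n k = (gbin Q n k)%:P.
Proof.
elim: n k => [|n IHn] [|k] //.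
by rewrite !gbinS !IHn polyCD polyCM polyC_exp.
Qed.

(** The factor of index n in the q-binomial theorem with u = q^n and v = - x
    vanishes at x = 1, so the derivative at 1 keeps only the other factors. *)
Lemma gauss_binomial_derivative (n : nat) :
  let t k := gbin q (2 * n).+1 k * ((-1) ^+ k * q ^+ ('C(k, 2) + n * ((2 * n).+1 - k))) in
  \sum_(k < (2 * n).+2) t k = 0 /\
  \sum_(k < (2 * n).+2) k%:R * t k =
    - (-1) ^+ n * q ^+ ('C(n, 2) + n * n + n) * qfact q n ^+ 2.
Proof.
move=> t; pose F (k : nat) : {poly ser} := (q ^+ n)%:P + (- 'X) * q%:P ^+ k.
pose A := \prod_(k < n) F k; pose B := \prod_(k < n) F (n + k.+1)%N.
have FE k : (F k).[1] = q ^+ n - q ^+ k by rewrite /F -polyC_exp !hornerE mulN1r.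
have Fn0 : (F n).[1] = 0 by rewrite FE subrr.
have dF : (F n)^`().[1] = - q ^+ n.
  by rewrite /F -polyC_exp derivD derivM derivN derivX !derivC mulr0 addr0 add0r !hornerE
    mulN1r.
have A1 : A.[1] = (-1) ^+ n * q ^+ 'C(n, 2) * qfact q n.
  rewrite /A horner_prod -prod_geometric /qfact [X in _ = _ * X](reindex_inj rev_ord_inj).
  rewrite -big_split; apply: eq_bigr => i _ /=; rewrite FE.
  have -> : q ^+ n = q ^+ i * q ^+ (n - i.+1).+1 by rewrite -exprD; congr (_ ^+ _);
    have := ltn_ord i; lia.
  by ring.
have B1 : B.[1] = q ^+ (n * n) * qfact q n.
  rewrite /B horner_prod exprM -[n in X in X * _]card_ord -prodr_const -big_split.
  by apply: eq_bigr => i _ /=; rewrite card_ord FE exprD; ring.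
have PE : A * (F n * B) = \sum_(k < (2 * n).+2) (t k)%:P * 'X^k.
  transitivity (\prod_(k < (2 * n).+1) F k).
    rewrite (_ : (2 * n).+1 = n + n.+1)%N; last by lia.
    rewrite big_split_ord /=; congr (_ * _); rewrite big_ord_recl /= addn0; congr (_ * _).
  rewrite gauss_binomial; apply: eq_bigr => k _.
  rewrite gbin_polyC -!polyC_exp -!polyCM -[- 'X]mulN1r exprMn -polyCN -!polyC_exp.
  rewrite mulrA -polyCM; congr (_%:P * _).
  by rewrite /t exprD -!exprM; ring.
split.
  have := congr1 (fun p : {poly ser} => p.[1]) PE; rewrite !hornerM Fn0 mul0r mulr0 horner_sum
    => E.
  by rewrite [RHS]E; apply: eq_bigr => k _; rewrite !hornerE expr1n mulr1.
have := congr1 (fun p : {poly ser} => p^`().[1]) PE.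
move: (F n) A B Fn0 dF A1 B1 {PE FE} => F' A B F0 dF A1 B1.
rewrite !derivM !(hornerD, hornerM) F0 dF A1 B1 raddf_sum horner_sum => E.
transitivity (\sum_(k < (2 * n).+2) ((t k)%:P * 'X^k)^`().[1]).
  apply: eq_bigr => k _; rewrite derivM derivC mul0r add0r derivXn hornerM hornerC hornerMn.
  by rewrite hornerXn expr1n mulrC.
by rewrite -E !exprD; ring.
Qed.

Lemma finite_jacobi_cube (n : nat) :
  \sum_(k < (2 * n).+2) gbin q (2 * n).+1 k *
     mono ((-1) ^+ `|k%:Z - n.+1%:Z|%N * (2 * (k%:Z - n.+1%:Z) + 1)) (tri (k%:Z - n.+1%:Z))
  = 2 * qfact q n ^+ 2.
Proof.
have := gauss_binomial_derivative n; set t := fun k => _ => -[t0 t1].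
pose E := ('C(n, 2) + n * n + n)%N.
apply: (@Xn_inj E); rewrite /=.
have s2 : ((-1) ^+ n) ^+ 2 = 1 :> ser by rewrite sqrr_sign.
transitivity ((-1) ^+ n * ((2 * n%:R + 1) * \sum_(k < (2 * n).+2) t k
    - 2 * \sum_(k < (2 * n).+2) k%:R * t k)); last first.
  rewrite t0 t1 -/E.
  transitivity (2 * ((-1) ^+ n) ^+ 2 * q ^+ E * qfact q n ^+ 2); first by ring.
  by rewrite s2; ring.
rewrite !mulr_sumr -sumrB mulr_sumr; apply: eq_bigr => k _; rewrite /t.
have kle : (k <= (2 * n).+1)%N by rewrite -ltnS.
set g := gbin _ _ _; rewrite monoE ?tri_ge0 // intrM rmorphXn /= intrN.
have -> : (2 * (k%:Z - n.+1%:Z) + 1)%:~R = 2 * (k%:R - n%:R) - 1 :> ser.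
  by rewrite rmorphD rmorphM rmorphB /= -!pmulrn -natr1; ring.
have -> : ('C(k, 2) + n * ((2 * n).+1 - k) = E + absz (tri (k%:Z - n.+1%:Z)))%N.
  apply/eqP; rewrite -eqz_nat /E !(PoszD, PoszM) -subzn // gez0_abs ?tri_ge0 //.
  have := tri2 (k%:Z - n.+1%:Z); have := bin2_int k; have := bin2_int n.
  by move: (tri _) 'C(n, 2) 'C(k, 2) => T Cn Ck h1 h2 h3; apply/eqP; lia.
have -> : (-1) ^+ `|k%:Z - n.+1%:Z|%N = - (-1) ^+ n * (-1) ^+ k :> ser.
  have -> : - (-1) ^+ n = (-1) ^+ n.+1 :> ser by rewrite exprS mulN1r.
  by rewrite -exprD -signr_odd -[RHS]signr_odd; congr (_ ^+ nat_of_bool _); lia.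
by rewrite exprD; ring.
Qed.

Lemma tri_ge (j : int) : `|j| <= tri j + 1%N%:Z.
Proof. by have := tri2 j; nia. Qed.

Lemma tri_tame : tame tri.
Proof. exact: tame_int tri_ge0 tri_ge. Qed.

Lemma jacobi_cube_int :
  qs (fun j => (-1) ^+ `|j|%N * (2 * j + 1)) tri = 2 * eul 1 ^+ 3.
Proof.
apply: eqXP => M; pose n := (2 * M).+2.
have hM : (2 * M + 1 < n.+1)%N by rewrite /n; lia.
have hN : (n.+1 + n.+1 <= (2 * n).+1 + 1)%N by lia.
apply: eqX_trans (eqX_sym (@gauss_limit 1 1 (fun j => (-1) ^+ `|j|%N * (2 * j + 1)) _ n.+1 (2
  * n).+1 M isT tri_ge hM hN)) _.
have -> : 2 * eul 1 ^+ 3 = eul 1 * (2 * (eul 1 * eul 1)) by ring.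
have qf : eqX M (qfact q n) (eul 1) by apply: (@qfact_lim 1) => //; rewrite /n; lia.
rewrite finite_jacobi_cube expr2; apply: eqXM => //; apply: eqXM => //.
exact: eqXM.
Qed.


(** * Dilation q -> q^k and dissection modulo k *)

Definition dil (k : nat) (f : ser) : ser :=
  FPS (fun n => if (k %| n)%N then coeffs f (n %/ k) else 0).

Definition sec (k r : nat) (f : ser) : ser := FPS (fun n => coeffs f (k * n + r)%N).

Lemma coeffs_dil k f n :
  coeffs (dil k f) n = if (k %| n)%N then coeffs f (n %/ k) else 0.
Proof. by []. Qed.

Lemma coeffs_sec k r f n : coeffs (sec k r f) n = coeffs f (k * n + r)%N.
Proof. by []. Qed.

Lemma sum_multiples (k r n : nat) (H : nat -> int) : (r < k)%N ->
  \sum_(j < (k * n + r).+1) (if (k %| j)%N then H j else 0) = \sum_(i < n.+1) H (k * i)%N.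
Proof.
move=> rk; elim: n => [|n IHn].
  rewrite muln0 add0n big_ord_recl dvdn0 big_ord1 muln0 big1 ?addr0 // => i _.
  by rewrite lift0 ifN // gtnNdvd // (leq_trans _ rk) // ltnS.
rewrite [RHS]big_ord_recr -IHn /= (_ : (k * n.+1 + r).+1 = ((k * n + r).+1 + k))%N; last by nia.
rewrite big_split_ord /=; congr (_ + _).
have lt_t : (k - r.+1 < k)%N by lia.
rewrite (bigD1 (Ordinal lt_t)) //= (_ : (k * n + r).+1 + (k - r.+1) = k * n.+1)%N; last by nia.
rewrite dvdn_mulr // big1 ?addr0 // => i ne_i.
rewrite ifN //; apply/negP => /dvdnP[m em]; move/eqP: ne_i; apply; apply: val_inj => /=.
have lt_i := ltn_ord i.
have m1 : (n < m)%N by rewrite -(ltn_pmul2r (m := k)); nia.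
have m2 : (m < n.+2)%N by rewrite -(ltn_pmul2r (m := k)); nia.
have em1 : m = n.+1 by lia.
by rewrite em1 in em; lia.
Qed.

Section Dilation.
Variables (k : nat) (k0 : (0 < k)%N).

Lemma coeffs_dil_mul (f : ser) n : coeffs (dil k f) (k * n)%N = coeffs f n.
Proof. by rewrite /= dvdn_mulr // mulKn. Qed.

Lemma sec_dil g : sec k 0 (dil k g) = g.
Proof. by apply: fpsP => n; rewrite -[RHS]coeffs_dil_mul -[in RHS](addn0 (k * n)%N). Qed.

(** A factor in q^k acts on the k-dissection as a scalar. *)
Lemma sec_dilM r (g f : ser) : (r < k)%N -> sec k r (dil k g * f) = g * sec k r f.
Proof.
move=> rk; apply: fpsP => n; rewrite [LHS]/=.
under eq_bigr => j _ do rewrite (fun_if (fun x => x * _)) mul0r.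
rewrite (@sum_multiples k r n (fun j => coeffs g (j %/ k) * coeffs f (k * n + r - j))) //.
rewrite coeffsM; apply: eq_bigr => i _; rewrite mulKn //=; congr (_ * coeffs f _).
by have := ltn_ord i; nia.
Qed.

Lemma dilM f g : dil k (f * g) = dil k f * dil k g.
Proof.
apply: fpsP => n; have [/dvdnP[m ->]|ndv] := boolP (k %| n)%N.
  rewrite mulnC coeffs_dil_mul -[in RHS](addn0 (k * m)%N).
  transitivity (coeffs (sec k 0 (dil k f * dil k g)) m) => //.
  by rewrite sec_dilM // sec_dil.
rewrite [LHS]/= (negPf ndv) coeffsM big1 // => j _ /=.
case: ifP => kj; last by rewrite mul0r.
case: ifP => [knj|_]; last by rewrite mulr0.
by case/negP: ndv; rewrite -(@subnKC j n) ?dvdn_addr // -ltnS.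
Qed.

Lemma dilD f g : dil k (f + g) = dil k f + dil k g.
Proof. by apply: fpsP => n /=; case: ifP; rewrite ?addr0. Qed.

Lemma dilN f : dil k (- f) = - dil k f.
Proof. by apply: fpsP => n /=; case: ifP; rewrite ?oppr0. Qed.

Lemma dil1 : dil k 1 = 1.
Proof.
apply: fpsP => n /=; case: ifP => [/dvdnP[m ->]|nd]; first by rewrite mulnK // muln_eq0 [k ==
  _]eqn0Ngt k0 orbF.
by case: n nd => //; rewrite dvdn0.
Qed.

Lemma dil_exp f n : dil k (f ^+ n) = dil k f ^+ n.
Proof. by elim: n => [|n IHn]; rewrite ?expr0 ?dil1 // !exprS dilM IHn. Qed.

Lemma dil_int (c : int) (f : ser) : dil k (c%:~R * f) = c%:~R * dil k f.
Proof.
by apply: fpsP => n; rewrite coeffs_intM !coeffs_dil coeffs_intM; case: ifP; rewrite ?mulr0.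
Qed.

Lemma dilX : dil k q = q ^+ k.
Proof.
apply: fpsP => n; rewrite coeffsXn /=; case: ifP => [/dvdnP[m ->]|nd].
  by rewrite mulnK // -{2}[k]mul1n eqn_pmul2r.
by case: eqP => // e; rewrite e dvdnn in nd.
Qed.

Lemma dil_prod (I : Type) (r : seq I) (P : pred I) (F : I -> ser) :
  dil k (\prod_(i <- r | P i) F i) = \prod_(i <- r | P i) dil k (F i).
Proof. exact: (big_morph _ dilM dil1). Qed.

Lemma dil_eqX N f g : eqX N f g -> eqX N (dil k f) (dil k g).
Proof.
by move=> fg i ltiN /=; case: ifP => // _; apply: fg; apply: leq_ltn_trans (leq_div _ _) ltiN.
Qed.

Lemma dil_qp s a b : (0 < a)%N -> (0 < b)%N -> dil k (qp s a b) = qp s (k * a) (k * b).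
Proof.
move=> a0 b0; rewrite !qpE; apply: iprod_unique => [|N].
  by apply: qp_near1; rewrite muln_gt0 k0.
exists N => //; apply: (eqX_trans (dil_eqX (iprodP (qp_near1 s a0 b0) (leqnn N)))).
rewrite dil_prod; apply: eqX_prod => i _.
by rewrite dilD dil1 dilN dil_int dil_exp dilX -exprM mulnDr mulnA.
Qed.

Lemma dil_qs (T : choiceType) (c e : T -> int) : dil k (qs c e) = qs c (fun i => k%:Z * e i).
Proof.
apply: fpsP => n /=; case: ifP => [/dvdnP[m ->]|nd].
  apply: eq_fsbigr => i _; rewrite mulnK //; congr (if _ then _ else _).
  by apply/eqP/eqP; nia.
rewrite fsbig1 // => i _; case: eqP => // ee; case/negP: (negbT nd).
by apply/dvdnP; exists (absz (e i)); nia.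
Qed.

Lemma dil_th s a b : dil k (th s a b) = th s (k * a) (k * b).
Proof. by rewrite dil_qs; apply: eq_qs => // j; rewrite !PoszM; ring. Qed.

Lemma secD r f g : sec k r (f + g) = sec k r f + sec k r g. Proof. exact: fpsP. Qed.
Lemma secN r f : sec k r (- f) = - sec k r f. Proof. exact: fpsP. Qed.

Lemma sec_int r (c : int) (f : ser) : sec k r (c%:~R * f) = c%:~R * sec k r f.
Proof. by apply: fpsP => n; rewrite coeffs_intM !coeffs_sec coeffs_intM. Qed.

Lemma secXS r f : sec k r.+1 (q * f) = sec k r f.
Proof. by apply: fpsP => n; rewrite coeffs_sec coeffsXM addnS. Qed.

Lemma secX0 f : sec k 0 (q * f) = q * sec k k.-1 f.
Proof.
apply: fpsP => n; rewrite coeffs_sec !coeffsXM addn0.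
case: n => [|n]; first by rewrite muln0.
by rewrite mulnS; case: k k0 => // j _; rewrite addSn /= addnC.
Qed.

End Dilation.

Lemma sec_dil_ne k r g : (0 < r)%N -> (r < k)%N -> sec k r (dil k g) = 0.
Proof.
move=> r0 rk; apply: fpsP => n /=; rewrite ifN // dvdn_addr ?dvdn_mulr //.
by rewrite gtnNdvd.
Qed.

Lemma dissect3 f :
  f = dil 3 (sec 3 0 f) + q * dil 3 (sec 3 1 f) + q ^+ 2 * dil 3 (sec 3 2 f).
Proof.
apply: fpsP => n; rewrite !coeffsD coeffsXM coeffsXnM.
have -> : (if n is m.+1 then coeffs (dil 3 (sec 3 1 f)) m else 0) =
  if (n %% 3 == 1)%N then coeffs f n else 0.
  case: n => [|n] //=; case: ifP => [/dvdnP[m ->]|nd]; last by case: eqP => //; lia.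
  by rewrite mulnK // ifT; [congr (coeffs f _)|]; lia.
have -> : (if (1 < n)%N then coeffs (dil 3 (sec 3 2 f)) (n - 2) else 0) =
  if (n %% 3 == 2)%N then coeffs f n else 0.
  case: ltnP => n1 /=; last by case: eqP => //; lia.
  case: ifP => [/dvdnP[m em]|nd]; last by case: eqP => //; lia.
  by rewrite em mulnK // ifT; [congr (coeffs f _)|]; lia.
have -> : coeffs (dil 3 (sec 3 0 f)) n = if (n %% 3 == 0)%N then coeffs f n else 0.
  rewrite /=; case: ifP => [/dvdnP[m ->]|nd]; last by case: eqP => //; lia.
  by rewrite mulnK // ifT; [congr (coeffs f _)|]; lia.
have [-> | [-> | ->]] : (n %% 3 = 0 \/ n %% 3 = 1 \/ n %% 3 = 2)%N by lia.
all: by rewrite /= ?addr0 ?add0r.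
Qed.

(** ** The cubic norm *)

(** [cnorm f] is the series g with g(q^3) = f(q) f(w q) f(w^2 q), w a primitive
    cube root of unity, written without w. *)
Definition cnorm (f : ser) : ser :=
  sec 3 0 f ^+ 3 + q * sec 3 1 f ^+ 3 + q ^+ 2 * sec 3 2 f ^+ 3
  - 3 * (q * (sec 3 0 f * sec 3 1 f * sec 3 2 f)).

Lemma sec3M f g :
  [/\ sec 3 0 (f * g) = sec 3 0 f * sec 3 0 g + q * (sec 3 1 f * sec 3 2 g + sec 3 2 f * sec 3
    1 g),
      sec 3 1 (f * g) = sec 3 0 f * sec 3 1 g + sec 3 1 f * sec 3 0 g + q * (sec 3 2 f * sec 3
        2 g) &
      sec 3 2 (f * g) = sec 3 0 f * sec 3 2 g + sec 3 1 f * sec 3 1 g + sec 3 2 f * sec 3 0 g].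
Proof.
have -> : f * g = dil 3 (sec 3 0 f) * g + dil 3 (sec 3 1 f) * (q * g) + dil 3 (sec 3 2 f) * (q
  * (q * g)).
  by rewrite {1}(dissect3 f); ring.
rewrite !secD !sec_dilM // !(secX0, secXS) //=.
by split; ring.
Qed.

(** The dissections of f and g multiply as elements of a cubic extension generated
    by a cube root of q. *)
Lemma cnormM f g : cnorm (f * g) = cnorm f * cnorm g.
Proof. by have [h0 h1 h2] := sec3M f g; rewrite /cnorm h0 h1 h2; ring. Qed.

Lemma sec3_Xn r e : (r < 3)%N -> sec 3 r (q ^+ e) = if (e %% 3 == r)%N then q ^+ (e %/ 3) else
  0.
Proof.
move=> r3; apply: fpsP => n; rewrite coeffs_sec coeffsXn.
case: eqP => [er|ner]; case: eqP => [ee|nee] //; first by rewrite coeffsXn; case: eqP => //;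
  lia.
  by lia.
by rewrite coeffsXn; case: eqP => //; lia.
Qed.

Lemma sec3_1 r : (r < 3)%N -> sec 3 r 1 = if r == 0%N then 1 else 0.
Proof. by case: r => [|[|[|r]]] // _; rewrite -(expr0 q) sec3_Xn. Qed.

Lemma cnorm_onesub e : (e %% 3 != 0)%N -> cnorm (1 - q ^+ e) = 1 - q ^+ e.
Proof.
move=> e3; rewrite /cnorm !secD !secN !sec3_1 // !sec3_Xn //=.
have eE : q ^+ e = q ^+ (e %% 3) * (q ^+ (e %/ 3)) ^+ 3.
  by rewrite {1}(divn_eq e 3) exprD exprM mulrC.
rewrite [in RHS]eE; have [er|er] : (e %% 3 = 1 \/ e %% 3 = 2)%N by lia.
all: by rewrite er /=; ring.
Qed.

Lemma cnorm_onesub3 e : cnorm (1 - q ^+ (3 * e)) = (1 - q ^+ e) ^+ 3.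
Proof.
rewrite /cnorm !secD !secN !sec3_1 // !sec3_Xn // modnMr mulKn //=.
by ring.
Qed.

Lemma cnorm1 : cnorm 1 = 1.
Proof. by rewrite /cnorm !sec3_1 //=; ring. Qed.

Lemma cnorm_prod (I : Type) (r : seq I) (P : pred I) (F : I -> ser) :
  cnorm (\prod_(i <- r | P i) F i) = \prod_(i <- r | P i) cnorm (F i).
Proof. exact: (big_morph _ cnormM cnorm1). Qed.

Lemma sec_eqX k r N f g : (0 < k)%N -> (r < k)%N -> eqX (k * N) f g -> eqX N (sec k r f) (sec
  k r g).
Proof. by move=> k0 rk fg i ltiN /=; apply: fg; nia. Qed.

Lemma eqX_exp N n f g : eqX N f g -> eqX N (f ^+ n) (g ^+ n).
Proof. by move=> fg; elim: n => [|n IHn] //; rewrite !exprS; apply: eqXM. Qed.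

Lemma eqXN N f g : eqX N f g -> eqX N (- f) (- g).
Proof. by move=> fg i ltiN; rewrite !coeffsN fg. Qed.

Lemma cnorm_eqX N f g : eqX (3 * N) f g -> eqX N (cnorm f) (cnorm g).
Proof.
move=> fg; have s r : (r < 3)%N -> eqX N (sec 3 r f) (sec 3 r g) by move=> r3; apply: sec_eqX.
by rewrite /cnorm; do !(apply: eqXD || apply: eqXN || apply: eqXM || apply: eqX_exp || apply:
  s || exact: eqX_refl).
Qed.

Lemma cnorm_iprod F : near1 F -> near1 (fun m => cnorm (F m)) ->
  cnorm (iprod F) = iprod (fun m => cnorm (F m)).
Proof.
move=> F1 cF1; apply: iprod_unique => // N; exists (3 * N)%N; first by lia.
by rewrite -cnorm_prod; apply: cnorm_eqX; apply: iprodP.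
Qed.

Lemma cnorm_qp a b : (a %% 3 != 0)%N -> (0 < b)%N -> cnorm (qp 1 a (3 * b)) = qp 1 a (3 * b).
Proof.
move=> a3 b0; have a0 : (0 < a)%N by case: a a3.
have b30 : (0 < 3 * b)%N by lia.
have cE m : cnorm (1 - 1%:~R * q ^+ (a + 3 * b * m)) = 1 - 1%:~R * q ^+ (a + 3 * b * m).
  by rewrite mul1r cnorm_onesub // addnC -mulnA mulnC modnMDl.
rewrite qpE cnorm_iprod; first by congr iprod; apply/funext => m; rewrite cE.
  exact: qp_near1.
by move=> m; rewrite cE; apply: qp_near1.
Qed.

Lemma cnorm_qp3 a b : (0 < a)%N -> (0 < b)%N -> cnorm (qp 1 (3 * a) (3 * b)) = qp 1 a b ^+ 3.
Proof.
move=> a0 b0; have a30 : (0 < 3 * a)%N by lia.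
have b30 : (0 < 3 * b)%N by lia.
have F1 := qp_near1 1 a0 b0.
have cE m : cnorm (1 - 1%:~R * q ^+ (3 * a + 3 * b * m)) =
   (1 - 1%:~R * q ^+ (a + b * m)) * ((1 - 1%:~R * q ^+ (a + b * m)) * (1 - 1%:~R * q ^+ (a + b
     * m))).
  by rewrite !mul1r -mulnA -mulnDr cnorm_onesub3 !exprS expr0 mulr1.
rewrite !qpE cnorm_iprod; last 2 first.
- exact: qp_near1.
- by have F3 := near1M F1 (near1M F1 F1); move=> m; rewrite cE; apply: F3.
rewrite !exprS expr0 mulr1 !iprodM //; last exact: near1M.
by congr iprod; apply/funext.
Qed.

(** A factor 1 - q^e is its own norm if 3 does not divide e, and has norm
    (1 - q^(e/3))^3 otherwise. *)
Lemma cnorm_eul k : (k %% 3 != 0)%N -> cnorm (eul k) * eul (3 * k) = eul k ^+ 4.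
Proof.
move=> k3; have k0 : (0 < k)%N by case: k k3.
have eulE : eul k = qp 1 k (3 * k) * qp 1 (2 * k) (3 * k) * eul (3 * k).
  rewrite {1}/eul (@qp_blocks 3) // !big_ord_recr /= big_ord0 mul1r mul0n addn0 mul1n.
  by congr (_ * qp _ _ _ * qp _ _ _); lia.
have -> : cnorm (eul k) = qp 1 k (3 * k) * qp 1 (2 * k) (3 * k) * eul k ^+ 3.
  rewrite [X in cnorm X]eulE !cnormM (@cnorm_qp k) // (@cnorm_qp (2 * k)) //; last by lia.
  by rewrite [X in cnorm X]/eul cnorm_qp3.
by rewrite [in RHS]exprS [X in _ = X * _]eulE; ring.
Qed.


(** * Splitting theta series *)

Lemma gsum_fin (T : finType) (F : T -> ser) : gsum F = \sum_i F i.
Proof.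
apply: fpsP => n; rewrite coeffs_sum /= (@fsbigE _ _ _ _ _ (index_enum T)) //.
- by apply: eq_big => // i; apply: mem_set.
- exact: index_enum_uniq.
by move=> i _; rewrite mem_index_enum.
Qed.

Lemma tame_comp (T U : choiceType) (h : T -> U) (e : U -> int) :
  injective h -> tame e -> tame (fun i => e (h i)).
Proof.
move=> ih [e0 fe]; split=> // N.
by apply: (finite_preimage _ (fe N)) => x y _ _; apply: ih.
Qed.

Lemma qs_fin_pair (T : finType) (U V : choiceType) (h : T * U -> V) (c e : V -> int) :
  bijective h -> tame e ->
  qs c e = \sum_i qs (fun u => c (h (i, u))) (fun u => e (h (i, u))).
Proof.
move=> bh te; rewrite {1}/qs (gsum_reindex _ bh) -gsum_fin.
pose G i u := mono (c (h (i, u))) (e (h (i, u))).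
have sG : summable (fun p : T * U => G p.1 p.2).
  apply: (@summable_mono _ (fun p => c (h (p.1, p.2))) (fun p => e (h (p.1, p.2)))).
  by apply: (@tame_comp _ _ (fun p => h (p.1, p.2))) => // -[x y] [x' y'] /(bij_inj bh).
by rewrite (gsum_pair sG); apply: eq_gsum => -[].
Qed.

Lemma qs_residues (k : nat) (c e : int -> int) : (0 < k)%N -> tame e ->
  qs c e = \sum_(r < k) qs (fun t => c (k%:Z * t + r%:Z)) (fun t => e (k%:Z * t + r%:Z)).
Proof.
move=> k0 te; pose h (p : 'I_k * int) := k%:Z * p.2 + p.1%:Z.
rewrite (@qs_fin_pair _ _ _ h) //.
have ltk (x : int) : (absz (x %% k%:Z)%Z < k)%N.
  by rewrite -ltz_nat gez0_abs ?modz_ge0 ?ltz_pmod //; lia.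
exists (fun x : int => (Ordinal (ltk x), (x %/ k%:Z)%Z)) => [[r t]|x] /=; last first.
  by rewrite /h /= gez0_abs ?modz_ge0 ?[_ * (_ %/ _)%Z]mulrC -?divz_eq //; lia.
have ltr : (r%:Z < `|k%:Z|) by have := ltn_ord r; lia.
congr (_, _); last by rewrite /h /= mulrC divzMDl ?divz_small ?addr0 //; lia.
by apply: val_inj; rewrite /= /h /= mulrC modzMDl modz_small //; have := ltn_ord r; lia.
Qed.

Lemma qs_reflect (c e c' e' : int -> int) (a : int) :
  (forall t, c (a - t) = c' t) -> (forall t, e (a - t) = e' t) -> qs c e = qs c' e'.
Proof. by apply: qs_reindex; exists (fun t => a - t) => t; ring. Qed.

Lemma gsum_fold (F : int -> ser) : summable F ->
  gsum F = gsum (fun n : nat => F n%:Z + F (-1 - n%:Z)).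
Proof.
move=> sF; pose h (p : bool * nat) := if p.1 then p.2%:Z else -1 - p.2%:Z.
have bh : bijective h.
  exists (fun x : int => if x is Posz n then (true, n) else (false, absz (- (x + 1))%R)).
    by move=> [[] n]; rewrite /h //=; case: n => // n; congr (_, _); lia.
  by case=> n; rewrite /h //=; lia.
have sFh (U : choiceType) (k : U -> int) : injective k -> summable (fun i => F (k i)).
  by move=> ik N; apply: (finite_preimage _ (sF N)) => x y _ _; apply: ik.
rewrite (gsum_reindex _ bh) gsumD; last 2 first.
- by apply: (sFh _ Posz) => x y [].
- by apply: (sFh _ (fun n : nat => -1 - n%:Z)) => x y; lia.
transitivity (gsum (fun b => gsum (fun n => F (h (b, n))))); last by rewrite gsum_fin big_bool.
rewrite gsum_pair; first by apply: eq_gsum => -[].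
by apply: (sFh _ (fun p => h (p.1, p.2))) => -[x y] [x' y'] /(bij_inj bh).
Qed.

(** Relates the bilateral series given by the triple product to the one-sided
    series of psi and of Jacobi's cube, whose exponents are triangular numbers. *)
Lemma qs_fold (c e : int -> int) (c' : nat -> int) : tame e ->
  (forall n : int, e (-1 - n) = e n) -> (forall n : nat, c n%:Z + c (-1 - n%:Z) = 2 * c' n) ->
  qs c e = 2 * qs c' (fun n : nat => e n%:Z).
Proof.
move=> te en cn; have tn : tame (fun n : nat => e n%:Z) by apply: tame_comp te => x y [].
rewrite {1}/qs gsum_fold; last exact: summable_mono.
have -> : (2 : ser) = 2%:~R by [].
rewrite -qs_const //; apply: eq_gsum => n; apply: fpsP => m; rewrite coeffsD /= en -cn.
by case: ifP; rewrite ?addr0.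
Qed.

Lemma sec_qs (T U : choiceType) (k r : nat) (h : T -> U) (c e : U -> int) (c' e' : T -> int) :
  (0 < k)%N -> injective h ->
  (forall i, c (h i) = c' i) -> (forall i, e (h i) = k%:Z * e' i + r%:Z) ->
  (forall p, (forall i, h i <> p) -> forall n : nat, e p <> k%:Z * n%:Z + r%:Z) ->
  sec k r (qs c e) = qs c' e'.
Proof.
move=> k0 ih cc ee nh; apply: fpsP => n; rewrite coeffs_sec /=.
rewrite -(fsbig_widen (range h) setT) //; last first.
  move=> p [_ np] /=; case: eqP => // ep; exfalso; apply: (nh p _ n).
    by move=> i hi; apply: np; exists i.
  by rewrite ep PoszD PoszM.
rewrite (@reindex_fsbig _ _ _ _ _ h setT).
  apply: eq_fsbigr => i _; rewrite cc ee; congr (if _ then _ else _).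
  by rewrite PoszD PoszM; apply/eqP/eqP; nia.
by apply: inj_bij => x y _ _; apply: ih.
Qed.

Lemma sign_parity (s : int) (m n : int) : s ^+ 2 = 1 -> (exists t : int, m - n = 2 * t) ->
  s ^+ `|m|%N = s ^+ `|n|%N.
Proof. by move=> s2 [t mt]; apply: sqr_sign => //; lia. Qed.

(** * Theta series as products *)

Definition phi : ser := th (-1) 1 1.
Definition psi : ser := th 1 1 3.

Lemma eul_unit k : (0 < k)%N -> eul k \is a GRing.unit.
Proof. by move=> k0; apply: qp_unit. Qed.

Lemma dil_eul k m : (0 < k)%N -> (0 < m)%N -> dil k (eul m) = eul (k * m).
Proof. by move=> k0 m0; apply: dil_qp. Qed.

Lemma eul_blocks k m : (0 < k)%N -> (0 < m)%N ->
  eul m = \prod_(i < k) qp 1 (i.+1 * m) (k * m).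
Proof.
move=> k0 m0; rewrite {1}/eul (qp_blocks 1 m0 m0 k0).
by apply: eq_bigr => i _; rewrite mulSn.
Qed.

Lemma eul2E m : (0 < m)%N -> eul m = qp 1 m (2 * m) * eul (2 * m).
Proof.
by move=> m0; rewrite (@eul_blocks 2) // !big_ord_recr /= big_ord0 mul1r mul1n.
Qed.

Lemma eul3E m : (0 < m)%N -> eul m = qp 1 m (3 * m) * qp 1 (2 * m) (3 * m) * eul (3 * m).
Proof.
by move=> m0; rewrite (@eul_blocks 3) // !big_ord_recr /= big_ord0 mul1r mul1n.
Qed.

Lemma phi_prod : phi * eul 2 = eul 1 ^+ 2.
Proof.
have -> : phi = qp 1 1 2 * qp 1 1 2 * eul 2 by exact: (@jacobi_triple_product (-1) 1 1).
by rewrite (@eul2E 1) //; ring.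
Qed.

Lemma psi_prod : psi * eul 1 = eul 2 ^+ 2.
Proof.
have -> : psi = qp (-1) 1 4 * qp (-1) 3 4 * eul 4 by exact: (@jacobi_triple_product 1 1 3).
have -> : eul 1 = qp 1 1 4 * qp 1 3 4 * eul 2.
  rewrite (@eul2E 1) // (@qp_blocks 2 1 1 2) // !big_ord_recr /= big_ord0 mul1r.
  by congr (qp _ _ _ * qp _ _ _ * eul _).
have -> : eul 2 = (qp 1 1 4 * qp (-1) 1 4) * (qp 1 3 4 * qp (-1) 3 4) * eul 4.
  rewrite (@qp_conj 1 4) // (@qp_conj 3 4) // (@eul2E 2) // (@qp_blocks 2 1 2 4) //
    !big_ord_recr /= big_ord0 mul1r.
  by congr (qp _ _ _ * qp _ _ _ * eul _).
ring.
Qed.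

Lemma pentagonal : th (-1) 1 2 = eul 1.
Proof. by rewrite (@eul3E 1) //; exact: (@jacobi_triple_product (-1) 1 2). Qed.

Lemma f12_prod : th 1 1 2 * (eul 1 * eul 6) = eul 2 * eul 3 ^+ 2.
Proof.
have -> : th 1 1 2 = qp (-1) 1 3 * qp (-1) 2 3 * eul 3 by exact: (@jacobi_triple_product 1 1 2).
have -> : eul 1 = qp 1 1 3 * qp 1 2 3 * eul 3 by exact: (@eul3E 1).
have -> : eul 2 = (qp 1 1 3 * qp (-1) 1 3) * (qp 1 2 3 * qp (-1) 2 3) * eul 6.
  by rewrite (@qp_conj 1 3) // (@qp_conj 2 3) // (@eul3E 2) //;
    congr (qp _ _ _ * qp _ _ _ * eul _).
ring.
Qed.

Lemma f15m_prod : th (-1) 1 5 * (eul 2 * eul 3) = eul 1 * eul 6 ^+ 2.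
Proof.
have -> : th (-1) 1 5 = qp 1 1 6 * qp 1 5 6 * eul 6 by exact: (@jacobi_triple_product (-1) 1 5).
have -> : eul 1 = qp 1 1 6 * qp 1 3 6 * qp 1 5 6 * eul 2.
  rewrite (@eul2E 1) // (@qp_blocks 3 1 1 2) // !big_ord_recr /= big_ord0 mul1r.
  by congr (qp _ _ _ * qp _ _ _ * qp _ _ _ * eul _).
have -> : eul 3 = qp 1 3 6 * eul 6 by exact: (@eul2E 3).
ring.
Qed.

(** Multiplying f(q, q^5) by f(-q, -q^5) gives a product in q^2, and the latter
    factor is known. *)
Lemma f15p_prod : th 1 1 5 * (eul 1 * (eul 4 * eul 6)) = eul 2 ^+ 2 * eul 3 * eul 12.
Proof.
have E : th 1 1 5 * th (-1) 1 5 * eul 12 = dil 2 (th (-1) 1 5) * eul 6 ^+ 2.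
  have -> : dil 2 (th (-1) 1 5) = (qp 1 1 6 * qp (-1) 1 6) * (qp 1 5 6 * qp (-1) 5 6) * eul 12.
    by rewrite dil_th // (@qp_conj 1 6) // (@qp_conj 5 6) //;
      exact: (@jacobi_triple_product (-1) 2 10).
  have -> : th (-1) 1 5 = qp 1 1 6 * qp 1 5 6 * eul 6 by exact: (@jacobi_triple_product (-1) 1
    5).
  have -> : th 1 1 5 = qp (-1) 1 6 * qp (-1) 5 6 * eul 6 by exact: (@jacobi_triple_product 1 1
    5).
  by ring.
have E1 := f15m_prod.
have E2 : dil 2 (th (-1) 1 5) * (eul 4 * eul 6) = eul 2 * eul 12 ^+ 2.
  by have := congr1 (dil 2) E1; rewrite expr2 !dilM // !dil_eul // expr2.
have u : eul 6 ^+ 2 * eul 12 \is a GRing.unit by rewrite unitrM unitrX !eul_unit.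
apply: (mulIr u).
transitivity (th 1 1 5 * eul 12 * (eul 4 * eul 6) * (eul 1 * eul 6 ^+ 2)); first by ring.
rewrite -E1; transitivity (th 1 1 5 * th (-1) 1 5 * eul 12 * ((eul 4 * eul 6) * (eul 2 * eul
  3))); first by ring.
rewrite E; transitivity (dil 2 (th (-1) 1 5) * (eul 4 * eul 6) * (eul 6 ^+ 2 * (eul 2 * eul
  3))); first by ring.
by rewrite E2; ring.
Qed.


Lemma int2_inj (x y : int) : 2 * x = 2 * y -> x = y.
Proof. lia. Qed.

Lemma mul2_inj (f g : ser) : 2 * f = 2 * g -> f = g.
Proof.
have two (h : ser) n : coeffs (2 * h) n = 2 * coeffs h n by exact: (coeffs_intM 2).
by move=> fg; apply: fpsP => n; apply: int2_inj; rewrite -!two fg.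
Qed.

Lemma tri_sum j : tri j + tri (- j) = j * j.
Proof. by have := tri2 j; have := tri2 (- j); lia. Qed.

Lemma tri_diff j : tri j - tri (- j) = j.
Proof. by have := tri2 j; have := tri2 (- j); lia. Qed.

(** Turns identities between exponents into polynomial identities, without the
    integer division of [tri]. *)
Lemma th_exp2 (a b : nat) j :
  2 * (a%:Z * tri j + b%:Z * tri (- j)) = (a%:Z + b%:Z) * (j * j) + (a%:Z - b%:Z) * j.
Proof.
have h1 := tri_sum j; have h2 := tri_diff j; rewrite -h1.
by move: (tri j) (tri (- j)) h2 => T T' h2; have -> : T = T' + j by [lia]; ring.
Qed.

Lemma phiE : phi = qs (fun j => (-1) ^+ `|j|%N) (fun j => j * j).
Proof. by apply: eq_qs => // j; rewrite !mul1r tri_sum. Qed.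

Lemma sqr_tame : tame (fun j : int => j * j).
Proof. by apply: (@tame_int _ 0) => j; nia. Qed.

Lemma psi_tri : 2 * psi = qs (fun=> 1) tri.
Proof.
rewrite (@qs_residues 2 _ tri) //; last exact: tri_tame.
rewrite !big_ord_recr /= big_ord0 add0r.
have -> : (2 : ser) = 1 + 1 by []; rewrite mulrDl mul1r; congr (_ + _).
  apply: (@qs_reflect _ _ _ _ 0) => // t; first by rewrite expr1n.
  by apply: int2_inj; rewrite th_exp2 tri2; ring.
apply: (@qs_reindex _ _ (fun t => t + 1)) => [|t|t].
- by exists (fun t => t - 1) => t; ring.
- by rewrite expr1n.
by apply: int2_inj; rewrite th_exp2 tri2; ring.
Qed.

Lemma tri_fold (n : int) : tri (-1 - n) = tri n.
Proof. by apply: int2_inj; rewrite !tri2; ring. Qed.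

Lemma psi_nat : psi = qs (fun=> 1) (fun n : nat => tri n%:Z).
Proof. by apply: mul2_inj; rewrite psi_tri (@qs_fold (fun=> 1) tri (fun=> 1) tri_tame
  tri_fold). Qed.

Definition odd_cubes (n : nat) : int := (-1) ^+ n * (2 * n%:Z + 1).

Lemma jacobi_cube : qs odd_cubes (fun n : nat => tri n%:Z) = eul 1 ^+ 3.
Proof.
apply: mul2_inj; rewrite -jacobi_cube_int; apply/esym.
apply: (@qs_fold _ _ odd_cubes tri_tame tri_fold) => n.
have -> : absz (-1 - n%:Z)%R = n.+1 by lia.
by rewrite /odd_cubes exprS /=; ring.
Qed.

(** ** Three-dissections *)

Lemma phi_dissect : phi = dil 9 phi - 2 * (q * dil 3 (th (-1) 1 5)).
Proof.
rewrite {1}phiE (@qs_residues 3) //; last exact: sqr_tame.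
rewrite !big_ord_recr /= big_ord0 add0r -addrA.
have pow3 (t : int) r r' : (exists u, r' = r + 2 * u) -> (-1 : int) ^+ absz (3%N%:Z * t + r)%R
  = (-1) ^+ absz (t + r')%R.
  by move=> [u ->]; apply: sign_parity => //; exists (t - u); lia.
congr (_ + _).
  rewrite phiE dil_qs //; apply: eq_qs => t; first by rewrite (@pow3 t 0 0) ?addr0 //; exists 0.
  by ring.
have te : tame (fun t : int => 9 * (t * t) + 6 * t) by apply: (@tame_int _ 1) => t; nia.
have thE : dil 3 (th (-1) 1 5) = qs (fun t => (-1) ^+ `|t|%N) (fun t => 9 * (t * t) + 6 * t).
  rewrite dil_qs //; apply: (@qs_reflect _ _ _ _ 0) => t; first by rewrite sub0r abszN.
  by apply: int2_inj; rewrite mulrCA th_exp2; ring.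
have qE : q * dil 3 (th (-1) 1 5) = qs (fun t => (-1) ^+ `|t|%N) (fun t => 9 * (t * t) + 6 * t
  + 1%N%:Z).
  by rewrite qs_shift // expr1 thE.
have nE : - (q * dil 3 (th (-1) 1 5)) = qs (fun t => (-1) ^+ absz (t + 1)%R) (fun t => 9 * (t
  * t) + 6 * t + 1%N%:Z).
  rewrite qE; transitivity ((-1)%:~R * qs (fun t => (-1) ^+ `|t|%N) (fun t => 9 * (t * t) + 6
    * t + 1%N%:Z)).
    by rewrite intrN mulN1r.
  rewrite -qs_const; last by apply: (@tame_int _ 1) => t; nia.
  apply: eq_qs => // t; rewrite -[-1 in LHS](expr1) -exprD; apply: sqr_sign => //; lia.
rewrite mulr2n mulrDl mul1r opprD nE; congr (_ + _).
  by apply: eq_qs => t; [rewrite (@pow3 t 1 1) //; exists 0 | ring].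
apply: (@qs_reflect _ _ _ _ (-1)) => t; last by ring.
by rewrite (@pow3 _ 2 2) //; [apply: sign_parity => //; exists (- t); lia | exists 0].
Qed.

Lemma psi_dissect : psi = dil 3 (th 1 1 2) + q * dil 9 psi.
Proof.
rewrite {1}/psi /th (@qs_residues 3) //; last exact: th_tame.
rewrite !big_ord_recr /= big_ord0 add0r.
rewrite addrAC; congr (_ + _).
  rewrite dil_th // [RHS](@qs_residues 2) //; last exact: th_tame.
  rewrite !big_ord_recr /= big_ord0 add0r; congr (_ + _).
    apply: eq_qs => t; first by rewrite !expr1n.
    by apply: int2_inj; rewrite !th_exp2; ring.
  apply: (@qs_reflect _ _ _ _ (-1)) => t; first by rewrite !expr1n.
  by apply: int2_inj; rewrite !th_exp2; ring.
rewrite dil_th // -{1}[q]expr1 -qs_shift; last exact: th_tame.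
apply: (@qs_reflect _ _ _ _ 0) => t; first by rewrite !expr1n.
by apply: int2_inj; rewrite [in RHS]mulrDr !th_exp2; ring.
Qed.

(** ** The theta identities behind the dissections *)

Definition Om : ser := th (-1) 1 5.

Lemma phi_psi : phi * psi = eul 1 * eul 2.
Proof.
have u : eul 2 * eul 1 \is a GRing.unit by rewrite unitrM !eul_unit.
apply: (mulIr u); transitivity ((phi * eul 2) * (psi * eul 1)); first by ring.
by rewrite phi_prod psi_prod; ring.
Qed.

Lemma phi_eul k : (0 < k)%N -> dil k phi * eul (k * 2) = eul k ^+ 2.
Proof.
move=> k0; have := congr1 (dil k) phi_prod.
by rewrite expr2 !dilM // !dil_eul // muln1 expr2.
Qed.

Lemma psi_eul k : (0 < k)%N -> dil k psi * eul k = eul (k * 2) ^+ 2.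
Proof.
move=> k0; have := congr1 (dil k) psi_prod.
by rewrite expr2 !dilM // !dil_eul // muln1 expr2.
Qed.

Lemma f12_Om : th 1 1 2 * Om = dil 3 phi * dil 3 psi.
Proof.
have -> : dil 3 phi * dil 3 psi = eul 3 * eul 6.
  by rewrite -dilM // phi_psi dilM // !dil_eul.
have u : (eul 1 * eul 6) * (eul 2 * eul 3) \is a GRing.unit by rewrite !unitrM !eul_unit.
apply: (mulIr u).
transitivity ((th 1 1 2 * (eul 1 * eul 6)) * (Om * (eul 2 * eul 3))); first by ring.
by rewrite f12_prod f15m_prod; ring.
Qed.

(** The left-hand side is phi(q^3) times the norm of phi computed from the
    3-dissection; the right-hand side comes from the norm of J_1^2 / J_2. *)
Lemma phi_cubic : dil 3 phi * (dil 3 phi ^+ 3 - 8 * (q * Om ^+ 3)) = phi ^+ 4.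
Proof.
have [s0 s1 s2] : [/\ sec 3 0 phi = dil 3 phi, sec 3 1 phi = - (2 * Om) & sec 3 2 phi = 0].
  have E : phi = dil 3 (dil 3 phi) + q * dil 3 (- (2 * Om)).
    rewrite {1}phi_dissect; have -> : dil 9 phi = dil 3 (dil 3 phi) by rewrite !dil_th.
    by rewrite dilN // (_ : 2 * Om = Om + Om) ?dilD //; [rewrite /Om|]; ring.
  have S (X Y : ser) : [/\ sec 3 0 (dil 3 X + q * dil 3 Y) = X, sec 3 1 (dil 3 X + q * dil 3
    Y) = Y
      & sec 3 2 (dil 3 X + q * dil 3 Y) = 0].
    by rewrite !secD !(secX0, secXS) //= !sec_dil // !sec_dil_ne // mulr0 !addr0 add0r.
  by have := S (dil 3 phi) (- (2 * Om)); rewrite -E.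
have N1 : cnorm phi = dil 3 phi ^+ 3 - 8 * (q * Om ^+ 3).
  by rewrite /cnorm s0 s1 s2; ring.
have N2 : cnorm phi * cnorm (eul 2) = cnorm (eul 1) ^+ 2.
  by rewrite -cnormM phi_prod expr2 cnormM -expr2.
have N3 := @cnorm_eul 1 isT; have N4 := @cnorm_eul 2 isT.
rewrite -N1.
have u : eul 2 ^+ 4 * eul 3 ^+ 2 \is a GRing.unit by rewrite !unitrM !eul_unit.
apply: (mulIr u).
transitivity ((cnorm phi * cnorm (eul 2)) * (dil 3 phi * eul (3 * 2)) * eul 3 ^+ 2).
  by rewrite -N4; ring.
rewrite N2 phi_eul //.
transitivity ((cnorm (eul 1) * eul (3 * 1)) ^+ 2 * eul 3 ^+ 2); first by ring.
rewrite N3; transitivity ((phi * eul 2) ^+ 4 * eul 3 ^+ 2); last by ring.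
by rewrite phi_prod; ring.
Qed.

(** ** The even part of (q^3; q^3)^3 / (q; q) *)

(** The exponent 3m^2 + 3n^2 - 2n is even exactly when m and n have the same
    parity, that is (m, n) = (u + v, u - v), and it then splits as a function of u
    plus a function of v. *)
Lemma even_part_phi_f15 : sec 2 0 (dil 3 phi * th 1 1 5) = eul 2 ^+ 2.
Proof.
pose e1 (j : int) := 3%N%:Z * (j * j).
pose e2 (j : int) := 3 * (j * j) - 2 * j.
have t1 : tame e1 by apply: (@tame_int _ 0) => j; rewrite /e1; nia.
have t2 : tame e2 by apply: (@tame_int _ 1) => j; rewrite /e2; nia.
have -> : dil 3 phi = qs (fun j => (-1) ^+ `|j|%N) e1 by rewrite phiE dil_qs.
have -> : th 1 1 5 = qs (fun=> 1) e2.
  by apply: eq_qs => j; [rewrite expr1n | apply: int2_inj; rewrite th_exp2 /e2; ring].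
rewrite qs_mul //.
pose f1 (j : int) := 3 * (j * j) - j.
pose f2 (j : int) := 3 * (j * j) + j.
have u1 : tame f1 by apply: (@tame_int _ 1) => j; rewrite /f1; nia.
have u2 : tame f2 by apply: (@tame_int _ 1) => j; rewrite /f2; nia.
have E1 : eul 2 = qs (fun j => (-1) ^+ `|j|%N) f1.
  have -> : eul 2 = dil 2 (eul 1) by rewrite dil_eul.
  rewrite -pentagonal dil_qs //; apply: eq_qs => // j.
  by apply: int2_inj; rewrite mulrCA th_exp2 /f1; ring.
have E2 : eul 2 = qs (fun j => (-1) ^+ `|j|%N) f2.
  rewrite E1; apply: (@qs_reflect _ _ _ _ 0) => j; first by rewrite sub0r abszN.
  by rewrite /f1 /f2; ring.
rewrite expr2 [X in X * _]E1 E2 qs_mul //.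
apply: (@sec_qs _ _ 2 0 (fun p : int * int => (p.1 + p.2, p.1 - p.2))) => //.
- by move=> [u v] [u' v'] [] /= h1 h2; congr (_, _); lia.
- move=> [u v] /=; rewrite mulr1 -exprD; apply: sqr_sign => //; lia.
- by move=> [u v] /=; rewrite /e1 /e2 /f1 /f2; ring.
move=> [m n] nh k /= e; have [t et] : exists t : int, m + n = 2 * t + 1.
  have [r0|r1] : ((m + n) %% 2)%Z = 0 \/ ((m + n) %% 2)%Z = 1 by lia.
    case: (nh (((m + n) %/ 2)%Z, ((m + n) %/ 2)%Z - n)); congr (_, _) => /=; lia.
  by exists ((m + n) %/ 2)%Z; lia.
have em : m = 2 * t + 1 - n by lia.
by move: e; rewrite /e1 /e2 em; lia.
Qed.

(** Reduces the even part of J_3^3 / J_1 to [even_part_phi_f15], since the remaining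
    factors phi(q^2) and phi(q^6) are series in q^2. *)
Lemma cube_quotient :
  eul 3 ^+ 3 * dil 2 phi = eul 1 * (dil 6 phi * (dil 3 phi * th 1 1 5)).
Proof.
have u : eul 4 * (eul 6 * eul 12) \is a GRing.unit by rewrite !unitrM !eul_unit.
apply: (mulIr u).
transitivity (eul 3 ^+ 3 * eul 6 * eul 12 * (dil 2 phi * eul (2 * 2))); first by ring.
rewrite phi_eul //.
transitivity ((th 1 1 5 * (eul 1 * (eul 4 * eul 6))) * (dil 6 phi * eul (6 * 2)) * dil 3 phi);
  last by ring.
rewrite f15p_prod phi_eul //.
transitivity (eul 2 ^+ 2 * eul 3 * eul 12 * eul 6 * (dil 3 phi * eul (3 * 2))); last by ring.
by rewrite phi_eul //; ring.
Qed.


(** * A Hecke-type double series for lambda *)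

Lemma gsum_nat (F : nat -> ser) N M : (forall i n, (n < i)%N -> coeffs (F i) n = 0) ->
  (N <= M)%N -> eqX N (gsum F) (\sum_(i < M) F i).
Proof.
move=> F0 leNM n ltnN; rewrite coeffs_sum [LHS]/= (@fsbigE _ _ _ _ _ (iota 0 M)) ?iota_uniq //.
  have -> : iota 0 M = index_iota 0 M by rewrite /index_iota subn0.
  rewrite big_mkord.
  by apply: eq_big => // i; apply: mem_set.
by move=> i _; rewrite mem_iota /= add0n -leqNgt => leMi; apply: F0; lia.
Qed.

Lemma sum_antidiagonal (H : nat -> nat -> ser) N :
  \sum_(r < N) \sum_(j < r.+1) H j (r - j)%N = \sum_(j < N) \sum_(i < N - j) H j i.
Proof.
elim: N => [|N IHN]; first by rewrite !big_ord0.
rewrite big_ord_recr IHN [RHS]big_ord_recr /= subSn // subnn big_ord1 big_ord_recr /= subnn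
  addrA.
congr (_ + _); rewrite -big_split; apply: eq_bigr => j _ /=.
by rewrite subSn ?big_ord_recr // ltnW.
Qed.

Lemma gsum_antidiagonal (H : nat -> nat -> ser) :
  (forall j i n, (n < j + i)%N -> coeffs (H j i) n = 0) ->
  gsum (fun j => gsum (H j)) = gsum (fun r => \sum_(j < r.+1) H j (r - j)%N).
Proof.
move=> H0.
have Hj j N M : (N <= M)%N -> eqX N (gsum (H j)) (\sum_(i < M) H j i).
  by apply: gsum_nat => i n ltni; apply: H0; lia.
apply: eqXP => N; apply: (eqX_trans (g := \sum_(j < N) gsum (H j))).
  apply: gsum_nat => // j n ltnj; rewrite (Hj j n.+1 n.+1) // coeffs_sum big1 // => i _.
  by apply: H0; lia.
apply: (eqX_trans (g := \sum_(r < N) \sum_(j < r.+1) H j (r - j)%N)); last first.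
  apply: eqX_sym; apply: gsum_nat => // r n ltnr; rewrite coeffs_sum big1 // => j _.
  by apply: H0; have := ltn_ord j; lia.
rewrite sum_antidiagonal; apply: eqX_sum => j _ n ltnN.
rewrite (Hj j N N) // !coeffs_sum.
rewrite -(big_mkord xpredT (fun i => coeffs (H j i) n)) (@big_cat_nat _ _ _ (N - j)%N 0 N)
  //=; last by lia.
rewrite big_mkord [X in _ + X]big_nat_cond [X in _ + X]big1 ?addr0 // => i /andP[/andP[h1 h2]
  _].
by apply: H0; lia.
Qed.

Definition qrise (i m : nat) : ser := \prod_(k < m) (1 - q ^+ (i + k.+1)).

Lemma qriseS i m : qrise i m.+1 = qrise i m * (1 - q ^+ (i + m.+1)).
Proof. exact: big_ord_recr. Qed.

Lemma qrise_shift i m : qrise i m.+1 = (1 - q ^+ i.+1) * qrise i.+1 m.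
Proof.
rewrite /qrise big_ord_recl addn1; congr (_ * _).
by apply: eq_bigr => k _; rewrite lift0 addnS.
Qed.

Lemma bin2S n : 'C(n.+1, 2) = ('C(n, 2) + n)%N.
Proof. by rewrite binS bin1. Qed.

Lemma bin2_ge i : (i <= 'C(i.+1, 2))%N.
Proof. by rewrite bin2S leq_addl. Qed.

(** The summand at j + 1 minus 1 - q^(2j+1) times the summand at j is a difference
    in i; the last term is what this telescoping leaves at i = M. *)
Lemma qrise_sum_step j M :
  \sum_(i < M) q ^+ 'C(i.+1, 2) * qrise i (2 * j.+1)
  = (1 - q ^+ (2 * j).+1) * \sum_(i < M) q ^+ 'C(i.+1, 2) * qrise i (2 * j)
    - q ^+ 'C(M.+1, 2) * (q ^+ (2 * j).+1 * (1 - q ^+ M) * qrise M (2 * j)).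
Proof.
elim: M => [|M IHM]; first by rewrite !big_ord0 expr0; ring.
rewrite !big_ord_recr /= IHM.
have -> : (2 * j.+1 = (2 * j).+2)%N by lia.
have := qrise_shift M (2 * j); rewrite qriseS => sh.
rewrite -[_ * (1 - q ^+ M.+1) * qrise M.+1 _]mulrA -sh !qriseS.
rewrite [in 'C(M.+2, 2)]bin2S !exprD !exprS; ring.
Qed.

Lemma coeffs_qbin_small i n (f : ser) : (n < i)%N -> coeffs (q ^+ 'C(i.+1, 2) * f) n = 0.
Proof. by move=> ltni; rewrite coeffsXnM ifN // -ltnNge (leq_trans ltni) ?bin2_ge. Qed.

Lemma qrise_sum j :
  gsum (fun i => q ^+ 'C(i.+1, 2) * qrise i (2 * j)) = qpoch q (q ^+ 2) j * psi.
Proof.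
elim: j => [|j IHj].
  rewrite /qpoch big_geq // mul1r psi_nat; apply: eq_gsum => i.
  by rewrite /qrise big_ord0 mulr1 tri_binS mono_nat mul1r.
have -> : qpoch q (q ^+ 2) j.+1 = (1 - q ^+ (2 * j).+1) * qpoch q (q ^+ 2) j.
  by rewrite /qpoch big_nat_recr //= mulrC -exprM -exprS.
rewrite -mulrA -IHj; apply: eqXP => N.
apply: (eqX_trans (g := \sum_(i < N) q ^+ 'C(i.+1, 2) * qrise i (2 * j.+1))).
  by apply: gsum_nat => // i n; apply: coeffs_qbin_small.
rewrite qrise_sum_step -[X in eqX _ _ X]subr0; apply: eqXD.
  apply: eqXM => //; apply: eqX_sym; apply: gsum_nat => // i n; exact: coeffs_qbin_small.
by apply: eqXN; apply: eqX_Xn0; apply: bin2_ge.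
Qed.

Definition qneg (j : nat) : ser := (qpoch (- q) q j)^-1.

Lemma qnegS j : qneg j = qneg j.+1 * (1 + q ^+ j.+1).
Proof.
rewrite /qneg; have -> : qpoch (- q) q j.+1 = qpoch (- q) q j * (1 + q ^+ j.+1).
  by rewrite /qpoch big_nat_recr //= mulNr opprK -exprS.
have u1 := qpoch_unit j; have u2 : (1 + q ^+ j.+1) \is a GRing.unit.
  by apply: coeffs0_unit; rewrite coeffsD coeffsXn.
by rewrite invrM // mulrAC mulVr // mul1r.
Qed.

Lemma qneg0 : qneg 0 = 1.
Proof. by rewrite /qneg /qpoch big_geq // invr1. Qed.

(** The terms of lambda psi on the diagonal i + j = r, up to the factor (-1)^r q^r. *)
Definition heckeF (r j : nat) : ser :=
  (-1) ^+ (r - j) * (q ^+ 'C(r - j, 2) * qrise (r - j) (2 * j) * qneg j).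

(** A q-Zeilberger certificate: the right-hand side is G(m) - G(m + 1), so that the
    sums of [heckeF] over j satisfy a first-order recursion in r. *)
Lemma heckeF_step d m (r := (d + m.+1)%N) :
  heckeF r.+1 m.+1 - q ^+ (3 * r + 2) * heckeF r m.+1
  = (-1) ^+ d.+1 * (q ^+ 'C(d.+2, 2) * (1 - q ^+ r.+1) * qrise d.+1 (2 * m).+1 * qneg m)
    - (-1) ^+ d * (q ^+ 'C(d.+1, 2) * (1 - q ^+ r.+1) * qrise d (2 * m.+1).+1 * qneg m.+1).
Proof.
rewrite /heckeF /r.
have -> : ((d + m.+1).+1 - m.+1 = d.+1)%N by lia.
rewrite addnK; have -> : (2 * m.+1 = (2 * m).+2)%N by lia.
have e1 : qrise d (2 * m).+3 = (1 - q ^+ d.+1) * qrise d.+1 (2 * m).+2 by rewrite qrise_shift.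
have e2 : qrise d (2 * m).+2 = (1 - q ^+ d.+1) * qrise d.+1 (2 * m).+1 by rewrite qrise_shift.
have e3 : qrise d.+1 (2 * m).+2 = qrise d.+1 (2 * m).+1 * (1 - q ^+ (d.+1 + (2 * m).+2)) by
  rewrite qriseS.
rewrite e1 e2 e3 (qnegS m) ['C(d.+2, 2)]bin2S ['C(d.+1, 2)]bin2S.
move: (qrise d.+1 _) (qneg _) 'C(d, 2) => P w c.
have -> : (3 * (d + m.+1) + 2 = d + d.+1 + d.+1 + m.+1 + m.+1 + m.+1)%N by lia.
have -> : ((d + m.+1).+1 = d.+1 + m.+1)%N by lia.
have -> : (d.+1 + (2 * m).+2 = d.+1 + m.+1 + m.+1)%N by lia.
rewrite !exprD !exprS; move: (q ^+ d) (q ^+ m) (q ^+ c) ((-1) ^+ d) => D M C s.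
ring.
Qed.

Lemma heckeF_partial r m : (m <= r)%N ->
  \sum_(j < m.+1) (heckeF r.+1 j - q ^+ (3 * r + 2) * heckeF r j)
  = 2 * ((-1) ^+ r.+1 * q ^+ 'C(r.+2, 2))
    - (-1) ^+ (r - m) * (q ^+ 'C((r - m).+1, 2) * (1 - q ^+ r.+1) * qrise (r - m) (2 * m).+1 *
      qneg m).
Proof.
elim: m => [_|m IHm lt_mr].
  rewrite big_ord1 /heckeF !subn0 /qrise !big_ord0 big_ord1 qneg0 addn1 !bin2S.
  have -> : (3 * r + 2 = r + r.+1 + r.+1)%N by lia.
  by rewrite !exprD !exprS; ring.
have [d er] : exists d, r = (d + m.+1)%N by exists (r - m.+1)%N; lia.
rewrite big_ord_recr IHm; last exact: ltnW.
subst r; have -> : (d + m.+1 - m = d.+1)%N by lia.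
by rewrite addnK; rewrite /= heckeF_step; ring.
Qed.

Definition heckeA (r : nat) : ser := \sum_(j < r.+1) heckeF r j.

Lemma heckeA_rec r :
  heckeA r.+1 = q ^+ (3 * r + 2) * heckeA r + 2 * ((-1) ^+ r.+1 * q ^+ 'C(r.+2, 2)).
Proof.
have := heckeF_partial (leqnn r); rewrite sumrB -mulr_sumr -/(heckeA r) subnn => E.
have lastE : heckeF r.+1 r.+1 = qrise 0 (2 * r).+2 * qneg r.+1.
  rewrite /heckeF subnn bin_small // !expr0 !mul1r; congr (qrise 0 _ * _).
  lia.
rewrite /heckeA big_ord_recr; move/(congr1 (fun f => f + q ^+ (3 * r + 2) * heckeA r)): E.
rewrite subrK => ->; rewrite [X in _ + X = _]lastE [qrise 0 (2 * r).+2]qriseS (qnegS r).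
have -> : 'C(1, 2) = 0%N by [].
have -> : (0 + (2 * r).+2 = r.+1 + r.+1)%N by lia.
by rewrite -/(heckeA r) !expr0 [q ^+ (r.+1 + _)]exprD; ring.
Qed.

(** The index i stands for j = i - r, which runs over the integers with |j| <= r. *)
Definition hecke_inner (r : nat) : ser :=
  \sum_(i < (2 * r).+1) mono ((-1) ^+ `|i%:Z - r%:Z|%N) (3 * tri r - (i%:Z - r%:Z) ^+ 2).

Lemma mono_shift c (e : int) (k : nat) : 0 <= e -> mono c (e + k%:Z) = q ^+ k * mono c e.
Proof. by move=> e0; rewrite -[q ^+ k]mul1r -(mono_nat 1) mono_mul // mul1r addrC. Qed.

Lemma hecke_innerS r :
  hecke_inner r.+1 = q ^+ (3 * r + 3) * hecke_inner r
    + 2 * ((-1) ^+ r.+1 * q ^+ ('C(r.+2, 2) + r.+1)).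
Proof.
have t1 : 2 * tri r.+1%:Z = r.+1%:Z * (r.+1%:Z + 1) := tri2 _.
have t0 : 2 * tri r%:Z = r%:Z * (r%:Z + 1) := tri2 _.
have edge (j : int) : `|j|%N = r.+1 ->
    mono ((-1) ^+ `|j|%N) (3 * tri r.+1%:Z - j ^+ 2) = (-1) ^+ r.+1 * q ^+ ('C(r.+2, 2) + r.+1).
  move=> ej; rewrite ej; have -> : 3 * tri r.+1%:Z - j ^+ 2 = ('C(r.+2, 2) + r.+1)%N%:Z.
    rewrite PoszD -tri_binS; have -> : j ^+ 2 = r.+1%:Z * r.+1%:Z by rewrite expr2; nia.
    by lia.
  by rewrite mono_nat rmorphXn /= intrN.
pose T (i : nat) := mono ((-1) ^+ `|i%:Z - r.+1%:Z|%N) (3 * tri r.+1%:Z - (i%:Z - r.+1%:Z) ^+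
  2).
transitivity (T 0%N + (\sum_(i < (2 * r).+1) T i.+1 + T (2 * r).+2)).
  have e : ((2 * r.+1).+1 = (2 * r).+3)%N by lia.
  rewrite /hecke_inner e big_ord_recl big_ord_recr; congr (_ + (_ + _)).
rewrite /T !edge; [|lia..]; rewrite addrC -addrA; congr (_ + _); last by ring.
rewrite /hecke_inner mulr_sumr; apply: eq_bigr => i _; have ir := ltn_ord i.
have -> : i.+1%:Z - r.+1%:Z = i%:Z - r%:Z by lia.
rewrite -mono_shift; last by rewrite expr2; nia.
by congr mono; rewrite PoszD; lia.
Qed.

(** Both sides satisfy the same first-order recursion: on the right, r -> r + 1 adds
    the two terms j = r + 1 and j = - r - 1. *)
Lemma heckeA_closed r : q ^+ r * heckeA r = hecke_inner r.
Proof.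
elim: r => [|r IHr].
  rewrite /heckeA /hecke_inner !big_ord1 /heckeF subnn /qrise big_ord0 qneg0 bin_small //.
  by rewrite expr0 /=; transitivity (mono 1 0); [rewrite (mono_nat 1 0); ring | congr mono].
rewrite heckeA_rec hecke_innerS -IHr !exprD !exprS; ring.
Qed.

(** By [qrise_sum] the j-th term of lambda times psi is a sum over i, and the double
    sum is collected along the diagonals i + j = r. *)
Lemma mock_lambda_hecke :
  psi * mock_lambda = gsum (fun r => (-1) ^+ r * hecke_inner r).
Proof.
have -> : mock_lambda = gsum lambda_term by [].
rewrite gsumMl; last first.
  move=> N; apply: (@sub_finite_set _ _ `I_N.+1); last exact: finite_II.
  by move=> n /= nz; rewrite ltnS leqNgt; apply/negP => /coeffs_lambda_term_eq0.
pose H (j i : nat) : ser := (-1) ^+ j * q ^+ j * qneg j * (q ^+ 'C(i.+1, 2) * qrise i (2 * j)).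
transitivity (gsum (fun j => gsum (H j))).
  apply: eq_gsum => j; rewrite /H -gsumMl.
    by rewrite qrise_sum /lambda_term /qneg; ring.
  move=> N; apply: (@sub_finite_set _ _ `I_N.+1); last exact: finite_II.
  move=> i /= nz; rewrite ltnS leqNgt; apply/negP => ltNi; apply: nz.
  by apply: coeffs_qbin_small.
rewrite gsum_antidiagonal => [|j i n ltn].
  apply: eq_gsum => r; rewrite -heckeA_closed /heckeA !mulr_sumr; apply: eq_bigr => j _.
  have [d er] : exists d, r = (d + j)%N by exists (r - j)%N; have := ltn_ord j; lia.
  have rj : (r - j = d)%N by lia.
  have sd : (-1) ^+ d * (-1) ^+ d = 1 :> ser by rewrite -expr2 sqrr_sign.
  rewrite /H /heckeF; move: (nat_of_ord j) rj er => k -> ->.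
  rewrite bin2S !exprD -[LHS]mul1r -{1}sd; ring.
have -> : H j i = q ^+ (j + 'C(i.+1, 2)) * ((-1) ^+ j * qneg j * qrise i (2 * j)).
  by rewrite /H exprD; ring.
by rewrite coeffsXnM ifN // -ltnNge (leq_trans ltn) // leq_add2l bin2_ge.
Qed.


(** * The even part of lambda *)

Lemma summable0 (T : choiceType) : summable (fun _ : T => 0).
Proof. by move=> N; apply: (@sub_finite_set _ _ set0). Qed.

Lemma summableD (T : choiceType) (F G : T -> ser) :
  summable F -> summable G -> summable (fun i => F i + G i).
Proof.
move=> sF sG N; apply: (sub_finite_set (B := ([set i | coeffs (F i) N <> 0] `|` [set i |
  coeffs (G i) N <> 0])%classic)).
  move=> i; rewrite /mkset coeffsD => nz.
  have [e|ne] := pselect (coeffs (F i) N = 0); [right|left] => //.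
  by rewrite e add0r in nz.
by rewrite finite_setU; split; [apply: sF | apply: sG].
Qed.

Lemma gsum_sum (T : choiceType) (n : nat) (F : nat -> T -> ser) :
  (forall i, summable (F i)) ->
  \sum_(i < n) gsum (F i) = gsum (fun k => \sum_(i < n) F i k) /\
  summable (fun k => \sum_(i < n) F i k).
Proof.
move=> sF; elim: n => [|n [IHn sn]].
  rewrite big_ord0; have -> : (fun k => \sum_(i < 0) F i k) = (fun=> 0).
    by apply/funext => k; rewrite big_ord0.
  by split; [apply: fpsP => N; rewrite /= fsbig1 | apply: summable0].
have -> : (fun k => \sum_(i < n.+1) F i k) = (fun k => \sum_(i < n) F i k + F n k).
  by apply/funext => k; rewrite big_ord_recr.
by split; [rewrite big_ord_recr IHn gsumD | apply: summableD].
Qed.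

Lemma coeffs_sign (k : nat) (f : ser) n : coeffs ((-1) ^+ k * f) n = (-1) ^+ k * coeffs f n.
Proof.
have -> : (-1) ^+ k = ((-1) ^+ k : int)%:~R :> ser by rewrite rmorphXn /= intrN.
exact: coeffs_intM.
Qed.

(** The coefficient of z^m in the product of the two bilateral series
    Sum_k (-1)^k z^k q^(k^2) and Sum_j (-1)^j z^j q^(3 tri r - j^2), |j| <= r,
    up to the sign (-1)^m. *)
Definition hecke_fiber (r : nat) (m : int) : ser :=
  \sum_(i < (2 * r).+1) mono 1 (3 * tri r + m ^+ 2 - 2 * m * (i%:Z - r%:Z)).

Lemma norm_le_sqr (d : int) : `|d| <= d ^+ 2.
Proof. by rewrite expr2; nia. Qed.

Lemma hecke_exp_ge (r i : nat) (m : int) : (i < (2 * r).+1)%N ->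
  r%:Z + (m - (i%:Z - r%:Z)) ^+ 2 <= 3 * tri r + m ^+ 2 - 2 * m * (i%:Z - r%:Z).
Proof. by have := tri2 r%:Z; rewrite !expr2; nia. Qed.

Lemma summable_fiber_term (r i : nat) : (i < (2 * r).+1)%N ->
  summable (fun m : int => mono ((-1) ^+ `|m|%N) (3 * tri r + m ^+ 2 - 2 * m * (i%:Z - r%:Z))).
Proof.
move=> ir; apply: summable_mono; apply: (@tame_int _ r) => m.
  by apply: le_trans (hecke_exp_ge m ir); rewrite addr_ge0 ?sqr_ge0.
by have := hecke_exp_ge m ir; have := norm_le_sqr (m - (i%:Z - r%:Z)); lia.
Qed.

Lemma phi_hecke_inner r :
  phi * hecke_inner r = gsum (fun m : int => (-1) ^+ `|m|%N * hecke_fiber r m).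
Proof.
rewrite /hecke_inner mulr_sumr.
pose F (i : nat) (m : int) : ser := if (i < (2 * r).+1)%N then
   mono ((-1) ^+ `|m|%N) (3 * tri r + m ^+ 2 - 2 * m * (i%:Z - r%:Z)) else 0.
have sF i : summable (F i).
  rewrite /F; case: ltnP => ir; first exact: summable_fiber_term.
  by move=> N; apply: (@sub_finite_set _ _ set0).
transitivity (\sum_(i < (2 * r).+1) gsum (F i)).
  apply: eq_bigr => i _; rewrite /F ltn_ord; have ir := ltn_ord i.
  rewrite mulrC phiE mulr_qs; last exact: sqr_tame.
  rewrite (@gsum_reindex _ _ (fun m => m - (i%:Z - r%:Z))); last first.
    by exists (fun m => m + (i%:Z - r%:Z)) => m; ring.
  apply: eq_gsum => m; rewrite mono_mul; last 2 first.
  - by have := hecke_exp_ge (i%:Z - r%:Z) ir; rewrite !expr2; lia.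
  - by rewrite -expr2 sqr_ge0.
  congr mono; last by ring.
  by rewrite -exprD; apply: sqr_sign => //; lia.
have [-> _] := gsum_sum (2 * r).+1 sF; apply: eq_gsum => m.
rewrite /hecke_fiber mulr_sumr; apply: eq_bigr => i _; rewrite /F ltn_ord.
apply: fpsP => n; rewrite coeffs_sign /=.
by case: ifP; rewrite ?mulr1 ?mulr0.
Qed.

Definition fiber_sum (m : int) : ser :=
  gsum (fun r : nat => (-1) ^+ r * ((-1) ^+ `|m|%N * hecke_fiber r m)).

Lemma summable_fibers :
  summable (fun p : nat * int => (-1) ^+ p.1 * ((-1) ^+ `|p.2|%N * hecke_fiber p.1 p.2)).
Proof.
move=> N; apply: (sub_finite_set _ (finite_setX (finite_II N.+1) (finite_int_bound (2 * N)))).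
move=> [r m]; rewrite /mkset !coeffs_sign => nz.
have {nz} : coeffs (hecke_fiber r m) N <> 0 by move=> z; apply: nz; rewrite z !mulr0.
rewrite coeffs_sum => nz.
have [i [ir ei]] : exists i : nat, (i < (2 * r).+1)%N /\
    3 * tri r + m ^+ 2 - 2 * m * (i%:Z - r%:Z) = N%:Z.
  apply: contrapT => no; apply: nz; rewrite big1 // => i _ /=; case: eqP => // ei.
  by case: no; exists i.
have := hecke_exp_ge m ir; rewrite ei => le; have := norm_le_sqr (m - (i%:Z - r%:Z)).
by split=> /=; lia.
Qed.

Lemma phi_psi_lambda : phi * (psi * mock_lambda) = gsum fiber_sum.
Proof.
rewrite mock_lambda_hecke gsumMl; last first.
  move=> N; apply: (@sub_finite_set _ _ `I_N.+1); last exact: finite_II.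
  move=> r; rewrite /mkset coeffs_sign => nz; rewrite /= ltnS leqNgt; apply/negP => ltNr;
    apply: nz.
  rewrite coeffs_sum big1 ?mulr0 // => i _ /=; case: eqP => // ei.
  by have := hecke_exp_ge (i%:Z - r%:Z) (ltn_ord i); move: ei; rewrite !expr2; lia.
rewrite -(gsum_exchange summable_fibers); apply: eq_gsum => r.
rewrite mulrCA phi_hecke_inner gsumMl // => N.
apply: (sub_finite_set _ (finite_preimage (f := fun m : int => (r, m)) _ (summable_fibers N))).
  move=> m nz z; apply: nz.
  have /eqP : coeffs ((-1) ^+ r * ((-1) ^+ `|m|%N * hecke_fiber r m)) N = 0 := z.
  by rewrite coeffs_sign mulf_eq0 signr_eq0 orFb => /eqP.
by move=> x y _ _ [].
Qed.

Lemma summable_gsum (T U : choiceType) (G : T -> U -> ser) :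
  summable (fun p : T * U => G p.1 p.2) -> summable (fun j => gsum (fun i => G i j)).
Proof.
move=> sG N; apply: (sub_finite_set _ (finite_image snd (sG N))) => j nz.
apply: contrapT => no; apply: nz; apply: fsbig1 => i _.
by apply: contrapT => nz; apply: no; exists (i, j).
Qed.

Lemma fiber_sum0 : fiber_sum 0 = eul 3 ^+ 3.
Proof.
have -> : eul 3 ^+ 3 = dil 3 (eul 1 ^+ 3) by rewrite dil_exp // dil_eul.
rewrite -jacobi_cube dil_qs //; apply: eq_gsum => r; rewrite expr0 mul1r /hecke_fiber.
under eq_bigr => i _ do rewrite mulr0 mul0r subr0 expr2 mul0r addr0.
apply: fpsP => n; rewrite coeffs_sign coeffs_sum /= sumr_const card_ord.
by case: ifP => _; rewrite ?mul0rn ?mulr0 // /odd_cubes -mulr_natl mulr1; congr (_ * _); lia.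
Qed.

Lemma fiber_sumN m : fiber_sum (- m) = fiber_sum m.
Proof.
apply: eq_gsum => r; rewrite abszN; congr (_ * (_ * _)).
rewrite /hecke_fiber (reindex_inj rev_ord_inj); apply: eq_bigr => i _ /=.
have ir := ltn_ord i; have -> : ((2 * r).+1 - i.+1)%N%:Z = 2 * r%:Z - i%:Z by lia.
by congr mono; ring.
Qed.

Lemma tame_shift (T : choiceType) (e : T -> int) (k : nat) : tame e -> tame (fun i => e i +
  k%:Z).
Proof.
move=> [e0 fe]; split=> [i|N]; first by rewrite addr_ge0.
by apply: sub_finite_set (fe N) => i /=; lia.
Qed.

Lemma bilateral_tame (m : nat) : tame (fun n => 3 * tri n + m%:Z ^+ 2 - 2 * m%:Z * n).
Proof.
pose e (n : int) := 3 * tri n + m%:Z ^+ 2 - 2 * m%:Z * n.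
have e2 n : 2 * e n = 2 * (m%:Z - n) ^+ 2 + n * (n + 3).
  transitivity (3 * (2 * tri n) + 2 * (m%:Z ^+ 2 - 2 * m%:Z * n)); first by rewrite /e; ring.
  by rewrite tri2; ring.
apply: (@tame_int e 3) => n; have := e2 n; have := sqr_ge0 (m%:Z - n); last by nia.
have [n0|[->|[->|n3]]] : 0 <= n \/ n = -1 \/ n = -2 \/ n <= -3 by lia.
- by nia.
- by rewrite expr2; nia.
- by rewrite expr2; nia.
by nia.
Qed.

(** The geometric sum over j collapses each fiber to the two terms with indices
    r and - r - 1 of a bilateral series. *)
Lemma fiber_sum_bilateral (m : nat) :
  (1 - q ^+ (2 * m)) * fiber_sum m =
  (-1) ^+ m * qs (fun n => (-1) ^+ `|n|%N) (fun n => 3 * tri n + m%:Z ^+ 2 - 2 * m%:Z * n).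
Proof.
have te := bilateral_tame m; set e := (fun n : int => _) in te *.
rewrite /qs gsum_fold; last exact: summable_mono.
have sF : summable (fun n : nat => mono ((-1) ^+ `|n%:Z|%N) (e n%:Z) + mono ((-1) ^+ absz (-1
  - n%:Z)%R) (e (-1 - n%:Z))).
  apply: summableD.
    by apply: (@summable_mono _ (fun n : nat => (-1) ^+ `|n%:Z|%N));
      apply: tame_comp te => x y [].
  apply: (@summable_mono _ (fun n : nat => (-1) ^+ absz (-1 - n%:Z)%R) (fun n : nat => e (-1 -
    n%:Z))).
  by apply: (@tame_comp _ _ (fun n : nat => -1 - n%:Z) e) => // x y; lia.
have sX : summable (fun r : nat => (-1) ^+ r * ((-1) ^+ m * hecke_fiber r m)).
  move=> N; apply: (sub_finite_set _ (finite_preimage (f := fun r : nat => (r, m%:Z)) _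
    (summable_fibers N))) => //.
  by move=> x y _ _ [].
rewrite /fiber_sum !gsumMl //; apply: eq_gsum => r.
have er0 : 0 <= e r%:Z by case: te.
have geom : (1 - q ^+ (2 * m)) * hecke_fiber r m = mono 1 (e r%:Z) - mono 1 (e (-1 - r%:Z)).
  have -> : hecke_fiber r m = mono 1 (e r%:Z) * \sum_(i < (2 * r).+1) (q ^+ (2 * m)) ^+ i.
    rewrite /hecke_fiber (reindex_inj rev_ord_inj) mulr_sumr; apply: eq_bigr => i _ /=.
    rewrite -exprM [RHS]mulrC -mono_shift //; congr mono; have ir := ltn_ord i.
    have -> : ((2 * r).+1 - i.+1)%N%:Z = 2 * r%:Z - i%:Z by lia.
    by rewrite /e !PoszM; ring.
  have -> : e (-1 - r%:Z) = e r%:Z + (2 * m * (2 * r).+1)%N%:Z.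
    have -> : (2 * m * (2 * r).+1)%N%:Z = 2 * m%:Z * (2 * r%:Z + 1).
      by rewrite !PoszM; congr (_ * _); lia.
    by rewrite /e tri_fold; ring.
  rewrite mono_shift // mulrCA -[1 - _]opprB mulNr -subrX1 -exprM; ring.
have monoZ c x : mono c x = c%:~R * mono 1 x.
  by apply: fpsP => n; rewrite coeffs_intM /=; case: ifP; rewrite ?mulr1 ?mulr0.
rewrite (monoZ _ (e r%:Z)) (monoZ _ (e (-1 - r%:Z))).
have -> : absz (-1 - r%:Z)%R = r.+1 by lia.
rewrite !rmorphXn /= !intrN exprS mulN1r.
transitivity ((-1) ^+ m * ((-1) ^+ r * ((1 - q ^+ (2 * m)) * hecke_fiber r m))); first by ring.
by rewrite geom; ring.
Qed.

(** Completing the square: the series is a shift of the pentagonal one if 3 does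
    not divide m, and is antisymmetric about n = (4m/3 - 1) / 2 otherwise. *)
Lemma bilateral_odd (m : nat) : exists c : int, exists k : nat,
  qs (fun n => (-1) ^+ `|n|%N) (fun n => 3 * tri n + m%:Z ^+ 2 - 2 * m%:Z * n)
  = c%:~R * (q ^+ (2 * k).+1 * eul 1).
Proof.
have [t [s [ms s3]]] : exists t : nat, exists s : nat, m = (3 * t + s)%N /\ (s < 3)%N.
  by exists (m %/ 3)%N, (m %% 3)%N; split; lia.
have T2 := bin2_int t.+1; set B := 'C(t.+1, 2) in T2.
have pent k : q ^+ k * eul 1 = qs (fun j => (-1) ^+ `|j|%N) (fun j => 1%N%:Z * tri j + 2%N%:Z
  * tri (- j) + k%:Z).
  by rewrite -pentagonal qs_shift //; apply: th_tame.
case: s s3 ms => [|[|[|//]]] _ ms.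
- exists 0, 0%N; rewrite mul0r; set e := (fun n : int => _ - _); set Z := qs _ _.
  have ZN : Z = - Z.
    transitivity (qs (fun n => -1 * (-1) ^+ `|n|%N) e).
      apply: (@qs_reflect _ _ _ _ (4 * t%:Z - 1)) => n.
        by rewrite -exprS; apply: sqr_sign => //; lia.
      by apply: int2_inj; rewrite /e !mulrBr !mulrDr ![2 * (3 * _)]mulrCA !tri2 ms PoszD
        PoszM; ring.
    by rewrite qs_const ?intrN ?mulN1r //; apply: bilateral_tame.
  by apply: mul2_inj; transitivity (Z + Z); [ring | rewrite {2}ZN; ring].
(* The exponent left over is 2k + 1 = 3t^2 + 5t + 1, then 3t^2 + 7t + 3. *)
- exists 1, (3 * B + t)%N; rewrite mul1r pent.
  apply: (@qs_reindex _ _ (fun n => n + 2 * t%:Z)) => [|n|n].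
  + by exists (fun n => n - 2 * t%:Z) => n; ring.
  + by apply: sqr_sign => //; lia.
  apply: int2_inj; rewrite [in RHS]mulrDr th_exp2 !mulrBr !mulrDr ![2 * (3 * _)]mulrCA !tri2.
  have -> : 2 * (2 * (3 * B + t)).+1%:Z = 6 * (2 * B%:Z) + 4 * t%:Z + 2 by lia.
  by rewrite T2 ms; ring.
exists (-1), (3 * B + 2 * t + 1)%N; rewrite pent -qs_const.
  apply: (@qs_reflect _ _ _ _ (2 * t%:Z + 1)) => n.
    by rewrite -exprS; apply: sqr_sign => //; lia.
  apply: int2_inj; rewrite [in RHS]mulrDr th_exp2 !mulrBr !mulrDr ![2 * (3 * _)]mulrCA !tri2.
  have -> : 2 * (2 * (3 * B + 2 * t + 1)).+1%:Z = 6 * (2 * B%:Z) + 8 * t%:Z + 6 by lia.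
  by rewrite T2 ms; ring.
by apply: tame_shift; apply: th_tame.
Qed.

Lemma sec2_odd k (f : ser) : sec 2 0 (q ^+ (2 * k).+1 * dil 2 f) = 0.
Proof.
have -> : q ^+ (2 * k).+1 * dil 2 f = q * dil 2 (q ^+ k * f).
  by rewrite dilM // dil_exp // dilX // -exprM exprS mulrA.
by rewrite secX0 // sec_dil_ne // mulr0.
Qed.

(** The factor 1 - q^(2m) is a series in q^2, so it does not affect the parity of
    the exponents. *)
Lemma fiber_sum_odd m : m != 0 -> sec 2 0 ((eul 1)^-1 * fiber_sum m) = 0.
Proof.
wlog mpos : m / 0 <= m => [H mn0|].
  have [/H|/ltW mneg] := lerP 0 m; first exact.
  by rewrite -fiber_sumN; apply: H; rewrite ?oppr_ge0 ?oppr_eq0.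
case: m mpos => // m _ mn0; have m0 : (0 < m)%N by lia.
have [c [k Ek]] := bilateral_odd m; have := fiber_sum_bilateral m.
rewrite Ek => E; have u : (1 - q ^+ m) \is a GRing.unit.
  by apply: coeffs0_unit; rewrite coeffsD coeffsN coeffsXn ltn_eqF // subr0.
apply: (mulrI u); rewrite mulr0 -sec_dilM //.
have -> : dil 2 (1 - q ^+ m) = 1 - q ^+ (2 * m) by rewrite dilD dil1 // dilN dil_exp // dilX
  // -exprM.
have -> : (1 - q ^+ (2 * m)) * ((eul 1)^-1 * fiber_sum m) = ((-1) ^+ m * c)%:~R * (q ^+ (2 *
  k).+1 * dil 2 1).
  rewrite mulrCA E dil1 // mulr1 intrM rmorphXn /= intrN.
  transitivity ((-1) ^+ m * c%:~R * (q ^+ (2 * k).+1 * ((eul 1)^-1 * eul 1))); first by ring.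
  by rewrite mulVr ?eul_unit // mulr1.
by rewrite sec_int sec2_odd mulr0.
Qed.

Definition lambda_even : ser := sec 2 0 mock_lambda.

(** By [fiber_sum_odd] only the fiber m = 0 contributes to the even part of
    lambda J_2 = (phi psi lambda) / J_1. *)
Lemma lambda_evenE : lambda_even * phi = psi * dil 3 phi.
Proof.
have u1 : eul 1 \is a GRing.unit by apply: eul_unit.
have E1 : (eul 1)^-1 * (phi * (psi * mock_lambda)) = dil 2 (eul 1) * mock_lambda.
  rewrite dil_eul // [phi * _]mulrA phi_psi -!mulrA mulKr //.
have E2 : sec 2 0 ((eul 1)^-1 * (phi * (psi * mock_lambda))) = sec 2 0 ((eul 1)^-1 * eul 3 ^+
  3).
  rewrite phi_psi_lambda -fiber_sum0.
  have sX : summable fiber_sum := summable_gsum summable_fibers.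
  rewrite gsumMl //; apply: fpsP => n; rewrite !coeffs_sec addn0 /=.
  rewrite (@fsbigTE _ _ _ _ [fset 0]%fset); first by rewrite big_seq_fset1.
  move=> m; rewrite in_fset1 => mn0.
  by have := congr1 (fun f => coeffs f n) (fiber_sum_odd mn0); rewrite coeffs_sec addn0.
have E3 : eul 1 * lambda_even = sec 2 0 ((eul 1)^-1 * eul 3 ^+ 3).
  by rewrite -E2 E1 sec_dilM.
have E4 : phi * sec 2 0 ((eul 1)^-1 * eul 3 ^+ 3) = dil 3 phi * eul 2 ^+ 2.
  rewrite -even_part_phi_f15 -!sec_dilM //; congr (sec 2 0 _).
  have -> : dil 2 (dil 3 phi) = dil 6 phi by rewrite !dil_th.
  rewrite mulrCA [dil 2 phi * _]mulrC cube_quotient mulKr //.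
apply: (mulrI u1); rewrite mulrA E3 mulrC E4 -psi_prod; ring.
Qed.


(** * The coefficients of lambda on the progression 6n + 4 *)

Definition lambda64 : ser := sec 3 2 lambda_even.

Lemma coeffs_lambda64 n : coeffs lambda64 n = coeffs mock_lambda (6 * n + 4)%N.
Proof. by rewrite /lambda64 /lambda_even !coeffs_sec; congr coeffs; lia. Qed.

Lemma coeffs0_phi : coeffs phi 0 = 1.
Proof.
have := congr1 (fun f => coeffs f 0) phi_prod.
by rewrite coeffs0_exp !coeffs0M !coeffs0_qp // mulr1 expr1n.
Qed.

(** Multiplying by the conjugates of phi makes the denominator a series in q^3. *)
Lemma lambda64_phi : lambda64 * phi ^+ 3 = 6 * (dil 3 psi * dil 3 phi ^+ 2 * Om).
Proof.
set F := dil 3 phi; set P := dil 3 psi.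
pose K := F ^+ 3 - 8 * (q * Om ^+ 3); pose A := th 1 1 2.
have AO : A * Om = F * P := f12_Om.
have phiD : phi = dil 3 F - 2 * (q * dil 3 Om).
  by rewrite {1}phi_dissect; congr (_ - _); rewrite /F /phi !dil_th.
have psiD : psi = dil 3 A + q * dil 3 P.
  by rewrite {1}psi_dissect; congr (_ + q * _); rewrite /P /psi !dil_th.
have two (f : ser) : dil 3 (2 * f) = 2 * dil 3 f by exact: (dil_int _ 2).
have four (f : ser) : dil 3 (4 * f) = 4 * dil 3 f by exact: (dil_int _ 4).
have eight (f : ser) : dil 3 (8 * f) = 8 * dil 3 f by exact: (dil_int _ 8).
(* C is the product of the two conjugates of phi under q -> w q, w^3 = 1. *)
pose C := dil 3 F ^+ 2 + 2 * (q * (dil 3 F * dil 3 Om)) + 4 * (q ^+ 2 * dil 3 Om ^+ 2).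
have CE : phi * C = dil 3 K.
  by rewrite /K /C dilD dilN eight !(dil_exp, dilM) // dilX // phiD; ring.
have psiC : psi * C = dil 3 (A * F ^+ 2 + 4 * (q * (P * Om ^+ 2)))
    + q * dil 3 (P * F ^+ 2 + 2 * (A * F * Om))
    + q * (q * dil 3 (4 * (A * Om) * Om + 2 * (P * F * Om))).
  rewrite !dilD -![4 * _ * Om]mulrA !four !two !(dil_exp, dilM) // dilX // psiD /C; ring.
have LK : lambda64 * K = 6 * (phi * P * F * Om).
  have : dil 3 K * lambda_even = dil 3 phi * (psi * C).
    transitivity (lambda_even * phi * C); first by rewrite -mulrA CE mulrC.
    by rewrite lambda_evenE; ring.
  move/(congr1 (sec 3 2)); rewrite psiC !sec_dilM // !secD !(secX0, secXS) //=.
  rewrite !sec_dil // !sec_dil_ne // AO -/lambda64 => E.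
  by rewrite mulrC E; ring.
have u : phi \is a GRing.unit by apply: coeffs0_unit; apply: coeffs0_phi.
apply: (mulrI u); transitivity (lambda64 * phi ^+ 4); first by ring.
rewrite -phi_cubic -/F -/K mulrCA LK; ring.
Qed.

(** * Partitions into distinct parts in two colours *)

Definition p2d_series : ser := FPS (fun n => (p_2d_nat n)%:Z).

(** The terms of the expanded product are indexed by the sets of coloured parts. *)
Lemma p2d_finite n :
  (p_2d_nat n)%:Z = coeffs (\prod_(m < n) ((1 + q ^+ m.+1) * (1 + q ^+ m.+1))) n.
Proof.
have -> : \prod_(m < n) ((1 + q ^+ m.+1) * (1 + q ^+ m.+1)) =
    \prod_(x : 'I_n * bool) (q ^+ x.1.+1 + 1).
  rewrite -(pair_big xpredT xpredT (fun (m : 'I_n) (b : bool) => q ^+ m.+1 + 1)) /=.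
  by apply: eq_bigr => m _; rewrite big_bool addrC.
rewrite bigA_distr coeffs_sum.
rewrite /p_2d_nat -sum1_card (big_morph Posz PoszD (erefl 0%:Z)) big_mkcond /=.
apply: eq_bigr => A _.
have -> : \prod_(x : 'I_n * bool) (if x \in A then q ^+ x.1.+1 else 1) = q ^+ (\sum_(x in A)
  x.1.+1).
  by rewrite -big_mkcond expr_sum.
by rewrite coeffsXn inE eq_sym; case: eqP.
Qed.

Lemma p2d_prod : p2d_series * eul 1 ^+ 2 = eul 2 ^+ 2.
Proof.
have -> : p2d_series = qp (-1) 1 1 * qp (-1) 1 1.
  have F1 : near1 (fun m => 1 - (-1)%:~R * q ^+ (1 + 1 * m)) by apply: qp_near1.
  have F2 := near1M F1 F1.
  rewrite qpE iprodM //; apply: fpsP => n; rewrite [LHS]p2d_finite.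
  rewrite (iprodP F2 (leqnn n.+1)) // big_ord_recr.
  have -> : \prod_(m < n) ((1 + q ^+ m.+1) * (1 + q ^+ m.+1)) =
      \prod_(m < n) ((1 - (-1)%:~R * q ^+ (1 + 1 * m)) * (1 - (-1)%:~R * q ^+ (1 + 1 * m))).
    by apply: eq_bigr => m _; rewrite add1n mul1n intrN mulN1r opprK.
  rewrite -[X in coeffs X _ = _]mulr1.
  by have := eqXM (eqX_refl (N := n.+1) _) (eqX_sym (@F2 n)); apply.
transitivity ((qp 1 1 1 * qp (-1) 1 1) ^+ 2); first by rewrite /eul; ring.
by rewrite qp_conj.
Qed.

(** * Extraction of coefficients *)

Lemma lambda64_prod :
  lambda64 * eul 1 ^+ 3 = 6 * (p2d_series * eul 6 ^+ 3 * dil 3 phi).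
Proof.
have u : eul 3 ^+ 2 * eul 6 * eul 1 ^+ 3 \is a GRing.unit by rewrite !unitrM !eul_unit.
have P3 := psi_eul (ltn0Sn 2); have F3 := phi_eul (ltn0Sn 2).
apply: (mulIr u); transitivity (lambda64 * (eul 1 ^+ 2) ^+ 3 * eul 3 ^+ 2 * eul 6);
  first by ring.
rewrite -phi_prod exprMn [lambda64 * _]mulrA lambda64_phi.
transitivity (6 * ((dil 3 psi * eul 3) * dil 3 phi * (dil 3 phi * eul (3 * 2)) * (Om * (eul 2
  * eul 3)) * eul 2 ^+ 2)).
  by ring.
rewrite P3 F3 f15m_prod -p2d_prod.
transitivity (6 * (eul 6 ^+ 2 * dil 3 phi * eul 3 ^+ 2 * (eul 1 * eul 6 ^+ 2) * (p2d_series *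
  eul 1 ^+ 2))) => //.
by ring.
Qed.

Lemma qs_addc (T : choiceType) (c c' e : T -> int) : tame e ->
  qs (fun i => c i + c' i) e = qs c e + qs c' e.
Proof.
move=> te; rewrite /qs -gsumD; [|exact: summable_mono|exact: summable_mono].
apply: eq_gsum => i; apply: fpsP => n; rewrite coeffsD /=.
by case: ifP; rewrite ?addr0.
Qed.

Definition sign_pos (k : nat) : int := if (0 < k)%N then (-1) ^+ k else 0.

Lemma sqr_nat_tame (a : nat) : (0 < a)%N -> tame (fun k : nat => a%:Z * (k%:Z * k%:Z)).
Proof. by move=> a0; apply: tame_nat => k; nia. Qed.

Lemma phi_unfold : phi = 1 + 2 * qs sign_pos (fun k : nat => k%:Z * k%:Z).
Proof.
pose c0 (j : int) : int := (j == 0)%:R.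
pose c1 (j : int) : int := if 0 < j then (-1) ^+ `|j|%N else 0.
have cE j : (-1) ^+ `|j|%N = c0 j + (c1 j + c1 (- j)).
  rewrite /c0 /c1 oppr_gt0 abszN; case: (ltrgtP j 0) => [j0|j0|->].
  - by rewrite add0r add0r.
  - by rewrite add0r addr0.
  by rewrite addr0.
rewrite phiE (eq_qs cE (fun=> erefl)) !qs_addc; try exact: sqr_tame.
have -> : qs (fun j => c1 (- j)) (fun j => j * j) = qs c1 (fun j => j * j).
  by apply: (@qs_reflect _ _ _ _ 0) => j; [rewrite sub0r opprK | ring].
have -> : qs c1 (fun j => j * j) = qs sign_pos (fun k : nat => k%:Z * k%:Z).
  rewrite {1}/qs gsum_fold; last by apply: summable_mono; apply: sqr_tame.
  apply: eq_gsum => k; apply: fpsP => n; rewrite coeffsD /=.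
  have -> : c1 (-1 - k%:Z) = 0 by rewrite /c1 ifN //; lia.
  by rewrite if_same addr0 /c1 ltz_nat.
have -> : qs c0 (fun j => j * j) = 1.
  apply: fpsP => n; rewrite coeffs1 /= (@fsbigTE _ _ _ _ [fset 0]%fset).
    by rewrite big_seq_fset1 mulr0 eq_sym; case: n.
  by move=> j; rewrite in_fset1 /c0 => /negPf ->; case: ifP.
ring.
Qed.

Lemma extend_by0_neg (a : nat -> int) (m : int) : m < 0 -> extend_by0 a m = 0.
Proof. by case: m. Qed.

Theorem theorem6p4 (n : nat) :
  \sum_(m \in [set: nat])
     (-1) ^+ m * (2 * m%:Z + 1) * P_lambda (6 * n%:Z - 3 * m%:Z * (m%:Z + 1) + 4)
  = 6 * (\sum_(l \in [set: nat])
           (-1) ^+ l * (2 * l%:Z + 1) * p_2d (n%:Z - 3 * l%:Z * (l%:Z + 1)))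
    + 12 * (\sum_(l \in [set: nat]) \sum_(k \in [set k : nat | (1 <= k)%N])
              (-1) ^+ (l + k) * (2 * l%:Z + 1)
              * p_2d (n%:Z - 3 * k%:Z ^+ 2 - 3 * l%:Z * (l%:Z + 1))).
Proof.
have t1 : tame (fun m : nat => tri m%:Z) by apply: tame_nat => m; have := tri2 m%:Z; nia.
have t6 : tame (fun m : nat => 6%N%:Z * tri m%:Z) by apply: tame_nat => m; have := tri2 m%:Z; nia.
have S6 : eul 6 ^+ 3 = qs odd_cubes (fun l : nat => 6%N%:Z * tri l%:Z).
  have -> : eul 6 ^+ 3 = dil 6 (eul 1 ^+ 3) by rewrite dil_exp // dil_eul.
  by rewrite -jacobi_cube dil_qs.
pose Phi := qs sign_pos (fun k : nat => 3%N%:Z * (k%:Z * k%:Z)).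
have F3 : dil 3 phi = 1 + 2 * Phi.
  by rewrite phi_unfold dilD dil1 // [dil 3 (2 * _)](dil_int _ 2) dil_qs.
have tri6 (l : nat) : 3 * l%:Z * (l%:Z + 1) = 6%N%:Z * tri l%:Z by have := tri2 l%:Z; lia.
have := congr1 (fun f => coeffs f n) lambda64_prod.
rewrite -jacobi_cube coeffs_mul_qs // F3 S6.
have -> : 6 * (p2d_series * qs odd_cubes (fun l : nat => 6%N%:Z * tri l%:Z) * (1 + 2 * Phi)) =
  6%:~R * (p2d_series * qs odd_cubes (fun l : nat => 6%N%:Z * tri l%:Z)) +
  12%:~R * (p2d_series * Phi * qs odd_cubes (fun l : nat => 6%N%:Z * tri l%:Z)) by ring.
rewrite coeffsD !coeffs_intM !coeffs_mul_qs // => E.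
transitivity (\sum_(i \in [set: nat]) odd_cubes i * extend_by0 (coeffs lambda64) (n%:Z - tri i%:Z)).
  apply: eq_fsbigr => m _; congr (_ * _); rewrite tri6.
  have -> : 6 * n%:Z - 6%N%:Z * tri m%:Z + 4 = 6 * (n%:Z - tri m%:Z) + 4 by lia.
  case: (n%:Z - tri m%:Z) => [k|k]; last by rewrite /P_lambda !extend_by0_neg //; lia.
  rewrite [RHS]coeffs_lambda64 /P_lambda.
  by have -> : 6 * Posz k + 4 = (6 * k + 4)%N%:Z by lia.
rewrite {}E; congr (6 * _ + 12 * _).
  by apply: eq_fsbigr => l _; rewrite tri6.
apply: eq_fsbigr => l _.
have extPhi (x : int) : extend_by0 (coeffs (p2d_series * Phi)) x =
    \sum_(k \in [set: nat]) sign_pos k * p_2d (x - 3%N%:Z * (k%:Z * k%:Z)).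
  case: x => x; first by rewrite [LHS]coeffs_mul_qs //; apply: sqr_nat_tame.
  by rewrite fsbig1 // => k _; rewrite /p_2d extend_by0_neg ?mulr0 //; nia.
rewrite extPhi mulr_fsumr [RHS]fsbig_mkcond; apply: eq_fsbigr => k _.
rewrite /patch /sign_pos; case: (posnP k) => [->|k0].
  by rewrite mul0r mulr0 ifN // notin_setE.
rewrite ifT; last by apply/mem_set.
rewrite /odd_cubes exprD tri6 expr2; have -> : n%:Z - 6%N%:Z * tri l%:Z - 3%N%:Z * (k%:Z * k%:Z) =
  n%:Z - 3 * (k%:Z * k%:Z) - 6%N%:Z * tri l%:Z by lia.
by ring.
Qed.
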